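(* Let $c,k\in\mathbb{R}$ with $k\neq 0$, and for $t\in\mathbb{R}$ and $f\in\mathcal{B}_{\infty,0}(\mathbb{D})$ let $T_tf(z)=e^{ict}f(e^{ikt}z)$, $z\in\mathbb{D}$. Then: (1) $(T_t)_{t\in\mathbb{R}}$ is a strongly continuous group of isometries on $\mathcal{B}_{\infty,0}(\mathbb{D})$. (2) The infinitesimal generator $\Gamma_{c,k}$ of $(T_t)_{t\in\mathbb{R}}$ on $\mathcal{B}_{\infty,0}(\mathbb{D})$ is given by $\Gamma_{c,k}f(z)=i\left(cf(z)+kzf'(z)\right)$ with domain $\mathcal{D}(\Gamma_{c,k})=\{f\in\mathcal{B}_{\infty,0}(\mathbb{D}): zf'\in\mathcal{B}_{\infty,0}(\mathbb{D})\}$.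
   Context: $\mathbb{D}=\{z\in\mathbb{C}:|z|<1\}$ and $\mathcal{H}(\mathbb{D})$ is the space of analytic functions on $\mathbb{D}$. The Bloch space $\mathcal{B}_\infty(\mathbb{D})$ is the Banach space of $f\in\mathcal{H}(\mathbb{D})$ with $\sup_{z\in\mathbb{D}}(1-|z|^2)|f'(z)|<\infty$, normed by $\|f\|_{\mathcal{B}_\infty(\mathbb{D})}=|f(0)|+\sup_{z\in\mathbb{D}}(1-|z|^2)|f'(z)|$. The little Bloch space $\mathcal{B}_{\infty,0}(\mathbb{D})$ is the closed subspace $\{f\in\mathcal{H}(\mathbb{D}):\lim_{|z|\to1^-}(1-|z|^2)|f'(z)|=0\}$ (equivalently, the closure of the polynomials in $\mathcal{B}_\infty(\mathbb{D})$), with the same norm. The infinitesimal generator $\Gamma$ of a strongly continuous group $(T_t)_{t\in\mathbb{R}}$ is $\Gamma f=\lim_{t\to0}(T_tf-f)/t$ (norm limit), with domain the set of $f$ for which the limit exists. *)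

(* Defs.v *)
From Stdlib Require Import Reals Lra Psatz FunctionalExtensionality ProofIrrelevance.
From Coquelicot Require Import Coquelicot.
Open Scope R_scope.

Definition in_disc (z : C) : Prop := Cmod z < 1.

(* The series are expanded around the arbitrary point [z0], so this is local
   power series representability; no global expansion at 0 is assumed. *)
Definition analytic_at (f : C -> C) (z0 : C) : Prop :=
  exists (a : nat -> C) (r : R), 0 < r /\
    forall z : C, Cmod (z - z0) < r ->
      @is_pseries C_AbsRing C_NormedModule a (z - z0)%C (f z).

(* Functions on the disc are carried by total functions [C -> C]; all the
   predicates below only look at their restriction to the disc. *)
Definition analytic_on_disc (f : C -> C) : Prop :=
  forall z0 : C, in_disc z0 -> analytic_at f z0.

(* [C_derive] is a limit along real increments; it is the complex derivative at
   points of analyticity, see [analytic_is_derive] below. *)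
Definition bloch_weight (f : C -> C) (z : C) : R :=
  (1 - Cmod z ^ 2) * Cmod (C_derive f z).

Definition in_bloch (f : C -> C) : Prop :=
  analytic_on_disc f /\
  exists M : R, forall z : C, in_disc z -> bloch_weight f z <= M.

Definition in_little_bloch (f : C -> C) : Prop :=
  in_bloch f /\
  forall eps : R, 0 < eps -> exists r : R, r < 1 /\
    forall z : C, r < Cmod z < 1 -> bloch_weight f z < eps.

Definition bloch_values (f : C -> C) (x : R) : Prop :=
  exists z : C, in_disc z /\ x = bloch_weight f z.

(* [Lub_Rbar] is finite on Bloch functions, the only ones this is used on. *)
Definition bloch_norm (f : C -> C) : R :=
  Cmod (f (RtoC 0)) + real (Lub_Rbar (bloch_values f)).

Lemma pseries_is_derive (f : C -> C) (a : nat -> C) (z0 : C) (r : R) :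
  0 < r ->
  (forall z : C, Cmod (z - z0) < r ->
     @is_pseries C_AbsRing C_NormedModule a (z - z0)%C (f z)) ->
  @is_derive C_AbsRing C_NormedModule f z0 (a 1%nat).
Proof.
  intros Hr Hf.
  assert (Hf0 : f z0 = a 0%nat).
  { assert (H0 : (z0 - z0)%C = RtoC 0) by ring.
    assert (H1 := Hf z0). rewrite H0 in H1. rewrite Cmod_0 in H1.
    specialize (H1 Hr).
    refine (@filterlim_locally_unique _ C_AbsRing C_NormedModule eventually _
              _ _ _ H1 _).
    apply (@is_pseries_0 C_AbsRing C_NormedModule). }
  set (rho := r / 2).
  assert (Hrho : 0 < rho) by (unfold rho; lra).
  assert (HM : exists M, 0 <= M /\ forall n, Cmod (a n) * rho ^ n <= M).
  { assert (Hz : Cmod ((z0 + RtoC rho) - z0) < r).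
    { replace ((z0 + RtoC rho) - z0)%C with (RtoC rho) by ring.
      rewrite Cmod_R, Rabs_pos_eq; unfold rho; lra. }
    assert (H1 := Hf _ Hz).
    destruct (@filterlim_bounded C_AbsRing C_NormedModule _
                (ex_intro _ _ H1)) as [M HM].
    assert (HM0 : 0 <= M).
    { eapply Rle_trans; [apply (@norm_ge_0 C_AbsRing C_NormedModule)|apply (HM 0%nat)]. }
    replace ((z0 + RtoC rho) - z0)%C with (RtoC rho) in HM by ring.
    assert (Hterm : forall n, Cmod (a n) * rho ^ n =
       @norm C_AbsRing C_NormedModule (scal (pow_n (RtoC rho : C_AbsRing) n) (a n))).
    { intros n. change (Cmod (a n) * rho ^ n
          = Cmod (Cmult (pow_n (RtoC rho : C_AbsRing) n) (a n))).
      rewrite Cmod_mult, Rmult_comm. f_equal.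
      induction n as [|n IH]; simpl.
      - change (1 = Cmod (RtoC 1)). now rewrite Cmod_1.
      - change (rho * rho ^ n = Cmod (Cmult (RtoC rho) (pow_n (RtoC rho : C_AbsRing) n))).
        rewrite Cmod_mult, <- IH, Cmod_R, Rabs_pos_eq; lra. }
    exists (2 * M). split; [lra|]. intros [|n].
    - rewrite Hterm. specialize (HM 0%nat). rewrite sum_O in HM.
      apply Rle_trans with M; [exact HM|lra].
    - rewrite Hterm.
      assert (HS := HM (S n)). assert (Hn := HM n).
      rewrite sum_Sn in HS.
      set (t := scal _ _) in *. set (s := sum_n _ n) in *.
      assert (Ht : Cmod t <= Cmod (s + t) + Cmod s).
      { replace t with ((s + t) - s)%C at 1 by ring.
        eapply Rle_trans; [apply Cmod_triangle|]. rewrite Cmod_opp. apply Rle_refl. }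
      change (Cmod (s + t) <= M) in HS. change (Cmod s <= M) in Hn.
      change (Cmod t <= 2 * M). lra. }
  destruct HM as [M [HM0 HM]].
  split.
  - apply is_linear_scal_l.
  - intros x Hx.
    apply (@is_filter_lim_locally_unique C_AbsRing (AbsRing_NormedModule C_AbsRing)) in Hx.
    subst x. intros eps.
    set (d := Rmin (rho / 2) (eps * rho ^ 2 / (2 * M + 1))).
    assert (Heps := cond_pos eps).
    assert (Hrho2 : 0 < rho ^ 2) by (apply pow_lt; lra).
    assert (Hd : 0 < d).
    { apply Rmin_pos; [lra|]. apply Rdiv_lt_0_compat; [nra|lra]. }
    exists (mkposreal d Hd). intros y Hy.
    change (Cmod (y - z0) < d) in Hy.
    change (Cmod (f y - f z0 - (y - z0) * a 1%nat) <= eps * Cmod (y - z0)).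
    rewrite Hf0.
    assert (Hh0 := Cmod_ge_0 (y - z0)).
    assert (Hd1 : d <= rho / 2) by apply Rmin_l.
    assert (Hd2 : d <= eps * rho ^ 2 / (2 * M + 1)) by apply Rmin_r.
    assert (Hyr : Cmod (y - z0) < r) by (unfold rho in *; lra).
    assert (Hs := Hf y Hyr). clear Hf.
    set (h := (y - z0)%C) in *.
    set (K := Cmod h ^ 2 * (M / rho ^ 2)).
    assert (HK0 : 0 <= K).
    { apply Rmult_le_pos; [apply pow_le; lra|]. apply Rdiv_le_0_compat; lra. }
    assert (Hpow : forall n, Cmod (pow_n (h : C_AbsRing) n) = Cmod h ^ n).
    { induction n as [|n IH]; simpl.
      - change (Cmod (RtoC 1) = 1). apply Cmod_1.
      - change (Cmod (Cmult h (pow_n (h : C_AbsRing) n)) = Cmod h * Cmod h ^ n).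
        now rewrite Cmod_mult, IH. }
    assert (Hsum : forall N,
      Cmod (sum_n (fun k => scal (pow_n (h : C_AbsRing) k) (a k : C_NormedModule)) (S N)
              - (a 0%nat + h * a 1%nat))
        <= K * (2 * (1 - (1 / 2) ^ N))).
    { induction N as [|N IH].
      - rewrite sum_Sn, sum_O.
        match goal with |- Cmod ?u <= _ => replace u with (RtoC 0) end.
        + rewrite Cmod_0. simpl. lra.
        + change (RtoC 0 = ((RtoC 1 * a 0%nat + (h * RtoC 1) * a 1%nat)
                           - (a 0%nat + h * a 1%nat))%C). ring.
      - rewrite sum_Sn.
        set (s := sum_n _ (S N)) in *.
        change (Cmod ((s + pow_n (h : C_AbsRing) (S (S N)) * a (S (S N)))
                      - (a 0%nat + h * a 1%nat)) <= K * (2 * (1 - (1 / 2) ^ S N))).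
        match goal with |- Cmod ?u <= _ => replace u with
          ((s - (a 0%nat + h * a 1%nat)) + pow_n (h : C_AbsRing) (S (S N)) * a (S (S N)))%C
            by ring end.
        eapply Rle_trans; [apply Cmod_triangle|].
        rewrite Cmod_mult, Hpow.
        assert (Ht : Cmod h ^ S (S N) * Cmod (a (S (S N))) <= K * (1 / 2) ^ N).
        { set (q := Cmod h / rho).
          assert (Hq0 : 0 <= q) by (apply Rdiv_le_0_compat; lra).
          assert (Hq : q <= 1 / 2).
          { unfold q. apply Rmult_le_reg_r with rho; [lra|].
            unfold Rdiv. rewrite Rmult_assoc, Rinv_l by lra. lra. }
          assert (Hhq : Cmod h = q * rho) by (unfold q; field; lra).
          assert (HKq : K = q ^ 2 * M) by (unfold K; rewrite Hhq; field; lra).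
          rewrite HKq, Hhq, Rpow_mult_distr.
          assert (Ha := HM (S (S N))).
          apply Rle_trans with (q ^ S (S N) * M).
          - replace (q ^ S (S N) * rho ^ S (S N) * Cmod (a (S (S N))))
              with (q ^ S (S N) * (Cmod (a (S (S N))) * rho ^ S (S N))) by ring.
            apply Rmult_le_compat_l; [apply pow_le; lra|exact Ha].
          - replace (q ^ S (S N)) with (q ^ 2 * q ^ N) by (simpl; ring).
            replace (q ^ 2 * M * (1 / 2) ^ N) with (q ^ 2 * (1 / 2) ^ N * M) by ring.
            apply Rmult_le_compat_r; [exact HM0|].
            apply Rmult_le_compat_l; [apply pow_le; lra|].
            apply pow_incr; lra. }
        simpl ((1 / 2) ^ S N). simpl (Cmod h ^ S (S N)) in *. lra. }
    assert (Hlim : Cmod (f y - (a 0%nat + h * a 1%nat)) <= 2 * K).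
    { assert (Hl : is_lim_seq
         (fun N => Cmod (sum_n (fun k => scal (pow_n (h : C_AbsRing) k)
                      (a k : C_NormedModule)) (S N) - (a 0%nat + h * a 1%nat)))
         (Cmod (f y - (a 0%nat + h * a 1%nat)))).
      { apply (is_lim_seq_incr_1 (fun N => Cmod (sum_n (fun k => scal (pow_n (h : C_AbsRing) k)
                      (a k : C_NormedModule)) N - (a 0%nat + h * a 1%nat)))).
        unfold is_lim_seq.
        eapply filterlim_comp with (G := locally
           ((f y - (a 0%nat + h * a 1%nat))%C : C_NormedModule)).
        2: apply (@filterlim_norm C_AbsRing C_NormedModule).
        refine (filterlim_comp_2 _
                  (fun _ => opp (a 0%nat + h * a 1%nat : C_NormedModule)%C)
                  (@plus C_NormedModule) Hs (filterlim_const _) _).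
        apply (@filterlim_plus C_AbsRing C_NormedModule). }
      refine (is_lim_seq_le _ _ (Finite _) (Finite _) _ Hl (is_lim_seq_const (2 * K))).
      intros N. eapply Rle_trans; [apply Hsum|].
      assert (0 <= (1 / 2) ^ N) by (apply pow_le; lra). nra. }
    match goal with |- Cmod ?u <= _ => replace u with
      (f y - (a 0%nat + h * a 1%nat))%C by ring end.
    eapply Rle_trans; [exact Hlim|].
    replace (2 * K) with ((2 * M / rho ^ 2 * Cmod h) * Cmod h)
      by (unfold K; field; lra).
    apply Rmult_le_compat_r; [exact Hh0|].
    apply Rle_trans with (2 * M / rho ^ 2 * (eps * rho ^ 2 / (2 * M + 1))).
    + apply Rmult_le_compat_l; [apply Rdiv_le_0_compat; lra|lra].
    + replace (2 * M / rho ^ 2 * (eps * rho ^ 2 / (2 * M + 1)))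
        with (eps * (2 * M / (2 * M + 1))) by (field; lra).
      rewrite <- (Rmult_1_r eps) at 2.
      apply Rmult_le_compat_l; [lra|].
      apply Rmult_le_reg_r with (2 * M + 1); [lra|].
      unfold Rdiv. rewrite Rmult_assoc, Rinv_l by lra. lra.
Qed.

Lemma analytic_is_derive (f : C -> C) (z : C) :
  analytic_at f z ->
  @is_derive C_AbsRing C_NormedModule f z (C_derive f z).
Proof.
  intros [a [r [Hr Hf]]].
  assert (H := pseries_is_derive f a z r Hr Hf).
  now rewrite (is_C_derive_unique _ _ _ H).
Qed.

Lemma analytic_plus (f g : C -> C) (z : C) :
  analytic_at f z -> analytic_at g z ->
  analytic_at (fun z => f z + g z)%C z.
Proof.
  intros [a [r [Hr Hf]]] [b [s [Hs Hg]]].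
  exists (@PS_plus C_AbsRing C_NormedModule a b), (Rmin r s). split.
  - now apply Rmin_pos.
  - intros y Hy. apply (@is_pseries_plus C_AbsRing C_NormedModule).
    + apply Hf. eapply Rlt_le_trans; [exact Hy|apply Rmin_l].
    + apply Hg. eapply Rlt_le_trans; [exact Hy|apply Rmin_r].
Qed.

Lemma analytic_scal (l : C) (f : C -> C) (z : C) :
  analytic_at f z -> analytic_at (fun z => l * f z)%C z.
Proof.
  intros [a [r [Hr Hf]]].
  exists (@PS_scal C_AbsRing C_NormedModule l a), r. split; [exact Hr|].
  intros y Hy. apply (@is_pseries_scal C_AbsRing C_NormedModule).
  - apply Cmult_comm.
  - now apply Hf.
Qed.

Lemma analytic_const (l z : C) : analytic_at (fun _ => l) z.
Proof.
  exists (fun n => match n with O => l | _ => RtoC 0 end), 1. split; [lra|].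
  intros y _. set (h := (y - z)%C).
  apply filterlim_ext with (fun _ : nat => l).
  - intros n. induction n as [|n IH].
    + rewrite sum_O. change (l = (RtoC 1 * l)%C). ring.
    + rewrite sum_Sn, <- IH.
      change (l = (l + pow_n (h : C_AbsRing) (S n) * RtoC 0)%C). ring.
  - apply filterlim_const.
Qed.

Lemma C_derive_plus (f g : C -> C) (z : C) :
  analytic_at f z -> analytic_at g z ->
  C_derive (fun z => f z + g z)%C z = (C_derive f z + C_derive g z)%C.
Proof.
  intros Hf Hg. apply is_C_derive_unique.
  apply (@is_derive_plus C_AbsRing C_NormedModule f g);
    now apply analytic_is_derive.
Qed.

Lemma C_derive_scal (l : C) (f : C -> C) (z : C) :
  analytic_at f z ->
  C_derive (fun z => l * f z)%C z = (l * C_derive f z)%C.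
Proof.
  intros Hf. apply is_C_derive_unique.
  apply analytic_is_derive in Hf.
  eapply filterdiff_ext_lin.
  - apply (@filterdiff_scal_r_fct C_AbsRing (AbsRing_NormedModule C_AbsRing) C_NormedModule
             _ _ l f _ Cmult_comm Hf).
  - intros y. change ((l * (y * C_derive f z))%C = (y * (l * C_derive f z))%C). ring.
Qed.

Lemma C_derive_const (l z : C) : C_derive (fun _ => l) z = RtoC 0.
Proof.
  apply is_C_derive_unique.
  apply (@is_derive_const C_AbsRing C_NormedModule).
Qed.

Lemma disc_weight_pos (z : C) : in_disc z -> 0 < 1 - Cmod z ^ 2.
Proof.
  intros Hz. unfold in_disc in Hz. assert (H := Cmod_ge_0 z). nra.
Qed.

Lemma bloch_weight_ge_0 (f : C -> C) (z : C) : in_disc z -> 0 <= bloch_weight f z.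
Proof.
  intros Hz. apply Rmult_le_pos; [apply Rlt_le, disc_weight_pos, Hz|apply Cmod_ge_0].
Qed.

Lemma bloch_weight_plus (f g : C -> C) (z : C) :
  analytic_on_disc f -> analytic_on_disc g -> in_disc z ->
  bloch_weight (fun z => f z + g z)%C z <= bloch_weight f z + bloch_weight g z.
Proof.
  intros Hf Hg Hz. unfold bloch_weight.
  rewrite C_derive_plus by auto.
  rewrite <- Rmult_plus_distr_l.
  apply Rmult_le_compat_l; [apply Rlt_le, disc_weight_pos, Hz|apply Cmod_triangle].
Qed.

Lemma bloch_weight_scal (l : C) (f : C -> C) (z : C) :
  analytic_on_disc f -> in_disc z ->
  bloch_weight (fun z => l * f z)%C z = Cmod l * bloch_weight f z.
Proof.
  intros Hf Hz. unfold bloch_weight.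
  rewrite C_derive_scal by auto. rewrite Cmod_mult. ring.
Qed.

Lemma in_little_bloch_plus (f g : C -> C) :
  in_little_bloch f -> in_little_bloch g ->
  in_little_bloch (fun z => f z + g z)%C.
Proof.
  intros [[Hf [M HM]] Lf] [[Hg [N HN]] Lg]. split; [split|].
  - intros z Hz. apply analytic_plus; auto.
  - exists (M + N). intros z Hz.
    eapply Rle_trans; [now apply bloch_weight_plus|].
    specialize (HM z Hz). specialize (HN z Hz). lra.
  - intros eps Heps.
    destruct (Lf (eps / 2)) as [r [Hr Hr']]; [lra|].
    destruct (Lg (eps / 2)) as [s [Hs Hs']]; [lra|].
    exists (Rmax r s). split; [now apply Rmax_lub_lt|].
    intros z [Hz1 Hz2].
    assert (r <= Rmax r s) by apply Rmax_l.
    assert (s <= Rmax r s) by apply Rmax_r.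
    assert (H1 := Hr' z ltac:(lra)). assert (H2 := Hs' z ltac:(lra)).
    assert (H3 := bloch_weight_plus f g z Hf Hg Hz2). lra.
Qed.

Lemma in_little_bloch_scal (l : C) (f : C -> C) :
  in_little_bloch f -> in_little_bloch (fun z => l * f z)%C.
Proof.
  intros [[Hf [M HM]] Lf].
  assert (Hl := Cmod_ge_0 l).
  split; [split|].
  - intros z Hz. apply analytic_scal; auto.
  - exists (Cmod l * M). intros z Hz.
    rewrite bloch_weight_scal by auto. apply Rmult_le_compat_l; auto.
  - intros eps Heps.
    destruct (Lf (eps / (Cmod l + 1))) as [r [Hr Hr']].
    { apply Rdiv_lt_0_compat; lra. }
    exists r. split; [exact Hr|].
    intros z Hz. rewrite bloch_weight_scal by (auto; apply Hz).
    specialize (Hr' z Hz).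
    assert (H0 := bloch_weight_ge_0 f z (proj2 Hz)).
    apply Rmult_lt_compat_r with (r := Cmod l + 1) in Hr'; [|lra].
    unfold Rdiv in Hr'. rewrite Rmult_assoc, Rinv_l in Hr' by lra. nra.
Qed.

Lemma in_little_bloch_zero : in_little_bloch (fun _ => RtoC 0).
Proof.
  assert (H : forall z, bloch_weight (fun _ => RtoC 0) z = 0).
  { intros z. unfold bloch_weight. rewrite C_derive_const, Cmod_0. ring. }
  split; [split|].
  - intros z _. apply analytic_const.
  - exists 0. intros z _. rewrite H. lra.
  - intros eps Heps. exists 0. split; [lra|]. intros z _. now rewrite H.
Qed.

(* Extension by 0 picks one total representative for each function on the
   disc, so that Leibniz equality is equality on the disc. *)
Record little_bloch : Type := LittleBloch {
  lb_fun :> C -> C;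
  lb_in : in_little_bloch lb_fun;
  lb_out : forall z : C, ~ in_disc z -> lb_fun z = RtoC 0
}.

Lemma little_bloch_ext (f g : little_bloch) :
  (forall z : C, in_disc z -> f z = g z) -> f = g.
Proof.
  destruct f as [f Hf Hf'], g as [g Hg Hg']. simpl. intros H.
  assert (E : f = g).
  { apply functional_extensionality. intros z.
    destruct (Rlt_dec (Cmod z) 1) as [Hz|Hz]; [now apply H|].
    now rewrite Hf', Hg'. }
  subst g. f_equal; apply proof_irrelevance.
Qed.

Definition lb_zero : little_bloch :=
  LittleBloch (fun _ => RtoC 0) in_little_bloch_zero (fun _ _ => eq_refl).

Lemma lb_plus_out (f g : little_bloch) (z : C) :
  ~ in_disc z -> (f z + g z)%C = RtoC 0.
Proof. intros Hz. rewrite !lb_out by exact Hz. ring. Qed.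

Definition lb_plus (f g : little_bloch) : little_bloch :=
  LittleBloch (fun z => f z + g z)%C
    (in_little_bloch_plus f g (lb_in f) (lb_in g)) (lb_plus_out f g).

Lemma lb_scal_out (l : C) (f : little_bloch) (z : C) :
  ~ in_disc z -> (l * f z)%C = RtoC 0.
Proof. intros Hz. rewrite lb_out by exact Hz. ring. Qed.

Definition lb_scal (l : C) (f : little_bloch) : little_bloch :=
  LittleBloch (fun z => l * f z)%C
    (in_little_bloch_scal l f (lb_in f)) (lb_scal_out l f).

Definition lb_opp (f : little_bloch) : little_bloch := lb_scal (- RtoC 1)%C f.

Definition lb_AbelianMonoid_mixin : AbelianMonoid.mixin_of little_bloch.
Proof.
  apply (AbelianMonoid.Mixin little_bloch lb_plus lb_zero);
    intros; apply little_bloch_ext; intros; simpl; ring.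
Defined.

Canonical lb_AbelianMonoid :=
  AbelianMonoid.Pack little_bloch lb_AbelianMonoid_mixin little_bloch.

Definition lb_AbelianGroup_mixin : AbelianGroup.mixin_of lb_AbelianMonoid.
Proof.
  apply (AbelianGroup.Mixin lb_AbelianMonoid lb_opp).
  intros; apply little_bloch_ext; intros; simpl; ring.
Defined.

Canonical lb_AbelianGroup :=
  AbelianGroup.Pack little_bloch
    (AbelianGroup.Class _ _ lb_AbelianGroup_mixin) little_bloch.

Definition lb_ModuleSpace_mixin : ModuleSpace.mixin_of C_Ring lb_AbelianGroup.
Proof.
  apply (ModuleSpace.Mixin C_Ring lb_AbelianGroup lb_scal); intros;
    apply little_bloch_ext; intros.
  - apply Cmult_assoc.
  - apply Cmult_1_l.
  - apply Cmult_plus_distr_l.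
  - apply Cmult_plus_distr_r.
Defined.

Canonical lb_ModuleSpace :=
  ModuleSpace.Pack C_Ring little_bloch
    (ModuleSpace.Class _ _ _ lb_ModuleSpace_mixin) little_bloch.

Lemma bloch_sup_finite (f : C -> C) :
  in_little_bloch f ->
  is_lub_Rbar (bloch_values f) (Finite (real (Lub_Rbar (bloch_values f)))).
Proof.
  intros [[_ [M HM]] _].
  assert (H := Lub_Rbar_correct (bloch_values f)).
  assert (H0 : in_disc (RtoC 0)) by (unfold in_disc; rewrite Cmod_0; lra).
  destruct (Lub_Rbar (bloch_values f)) as [l| |]; [exact H| |]; exfalso.
  - destruct H as [_ H]. apply (H (Finite M)).
    intros x [z [Hz ->]]. apply HM, Hz.
  - destruct H as [H _]. apply (H (bloch_weight f (RtoC 0))). now exists (RtoC 0).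
Qed.

Lemma bloch_weight_le_sup (f : C -> C) (z : C) :
  in_little_bloch f -> in_disc z ->
  bloch_weight f z <= real (Lub_Rbar (bloch_values f)).
Proof.
  intros Hf Hz. apply (proj1 (bloch_sup_finite f Hf)). now exists z.
Qed.

Lemma bloch_sup_le (f : C -> C) (M : R) :
  in_little_bloch f -> (forall z : C, in_disc z -> bloch_weight f z <= M) ->
  real (Lub_Rbar (bloch_values f)) <= M.
Proof.
  intros Hf HM. apply (proj2 (bloch_sup_finite f Hf) (Finite M)).
  intros x [z [Hz ->]]. now apply HM.
Qed.

Lemma bloch_sup_ge_0 (f : C -> C) :
  in_little_bloch f -> 0 <= real (Lub_Rbar (bloch_values f)).
Proof.
  intros Hf. assert (H0 : in_disc (RtoC 0)) by (unfold in_disc; rewrite Cmod_0; lra).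
  eapply Rle_trans; [apply (bloch_weight_ge_0 f (RtoC 0) H0)|].
  now apply bloch_weight_le_sup.
Qed.

Lemma bloch_norm_triangle (f g : little_bloch) :
  bloch_norm (lb_plus f g) <= bloch_norm f + bloch_norm g.
Proof.
  unfold bloch_norm.
  assert (H1 : Cmod (lb_plus f g (RtoC 0)) <= Cmod (f (RtoC 0)) + Cmod (g (RtoC 0)))
    by apply Cmod_triangle.
  assert (H2 : real (Lub_Rbar (bloch_values (lb_plus f g))) <=
     real (Lub_Rbar (bloch_values f)) + real (Lub_Rbar (bloch_values g))).
  { apply bloch_sup_le; [apply lb_in|]. intros z Hz.
    eapply Rle_trans; [apply bloch_weight_plus; auto; apply lb_in|].
    assert (A := bloch_weight_le_sup f z (lb_in f) Hz).
    assert (B := bloch_weight_le_sup g z (lb_in g) Hz). lra. }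
  lra.
Qed.

Lemma bloch_norm_scal (l : C) (f : little_bloch) :
  bloch_norm (lb_scal l f) <= Cmod l * bloch_norm f.
Proof.
  unfold bloch_norm.
  assert (H1 : Cmod (lb_scal l f (RtoC 0)) = Cmod l * Cmod (f (RtoC 0)))
    by apply Cmod_mult.
  assert (H2 : real (Lub_Rbar (bloch_values (lb_scal l f))) <=
     Cmod l * real (Lub_Rbar (bloch_values f))).
  { apply bloch_sup_le; [apply lb_in|]. intros z Hz.
    change (bloch_weight (fun z => l * f z)%C z <=
            Cmod l * real (Lub_Rbar (bloch_values f))).
    rewrite bloch_weight_scal; [|apply lb_in|exact Hz].
    apply Rmult_le_compat_l; [apply Cmod_ge_0|].
    now apply bloch_weight_le_sup; [apply lb_in|]. }
  lra.
Qed.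

Lemma bloch_norm_ge_0 (f : little_bloch) : 0 <= bloch_norm f.
Proof.
  apply Rplus_le_le_0_compat; [apply Cmod_ge_0|apply bloch_sup_ge_0, lb_in].
Qed.

Lemma bloch_norm_zero : bloch_norm lb_zero = 0.
Proof.
  assert (H : lb_zero = lb_scal (RtoC 0) lb_zero)
    by (apply little_bloch_ext; intros; simpl; ring).
  assert (H1 := bloch_norm_scal (RtoC 0) lb_zero).
  rewrite <- H, Cmod_0 in H1. assert (H2 := bloch_norm_ge_0 lb_zero). lra.
Qed.

Lemma bloch_norm_opp (f : little_bloch) : bloch_norm (lb_opp f) = bloch_norm f.
Proof.
  assert (Hm : Cmod (- RtoC 1) = 1) by (rewrite Cmod_opp; apply Cmod_1).
  apply Rle_antisym.
  - assert (H := bloch_norm_scal (- RtoC 1)%C f). rewrite Hm in H.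
    unfold lb_opp. lra.
  - assert (H := bloch_norm_scal (- RtoC 1)%C (lb_opp f)). rewrite Hm in H.
    replace (lb_scal (- RtoC 1)%C (lb_opp f)) with f in H; [lra|].
    apply little_bloch_ext; intros; simpl; ring.
Qed.

Lemma zero_derive_const (f : C -> C) (z : C) :
  analytic_on_disc f -> (forall w : C, in_disc w -> C_derive f w = RtoC 0) ->
  in_disc z -> f z = f (RtoC 0).
Proof.
  intros Hf Hd Hz.
  assert (Hseg : forall t, 0 <= t <= 1 -> in_disc (RtoC t * z)%C).
  { intros t Ht. unfold in_disc in *. rewrite Cmod_mult, Cmod_R, Rabs_pos_eq by lra.
    assert (H := Cmod_ge_0 z). nra. }
  assert (Hlim : forall (p : C -> R),
     (forall u v : C, Rabs (p u - p v) <= Cmod (u - v)) ->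
     p (f z) = p (f (RtoC 0))).
  { intros p Hp.
    destruct (MVT_cor2 (fun t => p (f (RtoC t * z)%C)) (fun _ => 0) 0 1) as [c [Hc _]].
    - lra.
    - intros t Ht eps Heps.
      assert (Hdt := analytic_is_derive f _ (Hf _ (Hseg t Ht))).
      rewrite Hd in Hdt by now apply Hseg.
      destruct Hdt as [_ Hdt].
      assert (Heps2 : 0 < eps / 2) by lra.
      destruct (Hdt (RtoC t * z)%C (fun P H => H) (mkposreal _ Heps2)) as [d Hd'].
      exists d. intros h Hh0 Hh.
      assert (Hzle : Cmod z <= 1) by (unfold in_disc in Hz; lra).
      assert (Hdiff : (RtoC (t + h) * z - RtoC t * z)%C = (RtoC h * z)%C)
        by (rewrite RtoC_plus; ring).
      assert (Hmod : Cmod (RtoC h * z) <= Rabs h).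
      { rewrite Cmod_mult, Cmod_R. assert (H := Rabs_pos h). nra. }
      assert (Hball : Cmod (RtoC (t + h) * z - RtoC t * z) < d).
      { rewrite Hdiff. lra. }
      assert (H1 := Hd' (RtoC (t + h) * z)%C Hball).
      change (Cmod (f (RtoC (t + h) * z)%C - f (RtoC t * z)%C
               - (RtoC (t + h) * z - RtoC t * z) * RtoC 0)
              <= eps / 2 * Cmod (RtoC (t + h) * z - RtoC t * z)) in H1.
      match type of H1 with Cmod ?u <= _ => replace u with
        (f (RtoC (t + h) * z)%C - f (RtoC t * z)%C)%C in H1 by ring end.
      rewrite Hdiff in H1.
      assert (H2 := Hp (f (RtoC (t + h) * z)%C) (f (RtoC t * z)%C)).
      assert (Hhpos : 0 < Rabs h) by now apply Rabs_pos_lt.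
      rewrite Rminus_0_r. unfold Rdiv. rewrite Rabs_mult, Rabs_inv.
      apply Rmult_lt_reg_r with (Rabs h); [exact Hhpos|].
      rewrite Rmult_assoc, Rinv_l by lra. nra.
    - replace (RtoC 1 * z)%C with z in Hc by ring.
      replace (RtoC 0 * z)%C with (RtoC 0) in Hc by ring. lra. }
  apply injective_projections.
  - apply (Hlim (fun u => fst u)). intros u v. apply (re_le_Cmod (u - v)%C).
  - apply (Hlim (fun u => snd u)). intros u v.
    eapply Rle_trans; [|apply (Rmax_Cmod (u - v)%C)]. apply Rmax_r.
Qed.

Lemma bloch_norm_eq_0 (f : little_bloch) : bloch_norm f = 0 -> f = lb_zero.
Proof.
  intros H. unfold bloch_norm in H.
  assert (H1 := Cmod_ge_0 (f (RtoC 0))).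
  assert (H2 := bloch_sup_ge_0 f (lb_in f)).
  assert (Hf0 : f (RtoC 0) = RtoC 0) by (apply Cmod_eq_0; lra).
  apply little_bloch_ext. intros z Hz. simpl. rewrite <- Hf0.
  apply zero_derive_const; [apply lb_in| |exact Hz].
  intros w Hw. apply Cmod_eq_0.
  assert (Hs := bloch_weight_le_sup f w (lb_in f) Hw).
  assert (Hp := disc_weight_pos w Hw).
  assert (Hc := Cmod_ge_0 (C_derive f w)).
  unfold bloch_weight in Hs. nra.
Qed.

Definition lb_ball (f : little_bloch) (eps : R) (g : little_bloch) : Prop :=
  bloch_norm (minus g f) < eps.

Definition lb_UniformSpace_mixin : UniformSpace.mixin_of little_bloch.
Proof.
  apply (UniformSpace.Mixin little_bloch lb_zero lb_ball).
  - intros f [e He]. unfold lb_ball. rewrite minus_eq_zero.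
    change (bloch_norm lb_zero < e). now rewrite bloch_norm_zero.
  - intros f g e. unfold lb_ball. intros H. rewrite <- opp_minus.
    change (bloch_norm (lb_opp (minus g f)) < e). now rewrite bloch_norm_opp.
  - intros f g h e1 e2 H1 H2. unfold lb_ball in *.
    rewrite (minus_trans g).
    eapply Rle_lt_trans; [apply bloch_norm_triangle|]. lra.
Defined.

Canonical lb_UniformSpace :=
  UniformSpace.Pack little_bloch lb_UniformSpace_mixin little_bloch.

Canonical lb_NormedModuleAux :=
  NormedModuleAux.Pack C_AbsRing little_bloch
    (NormedModuleAux.Class C_AbsRing little_bloch
       (ModuleSpace.class C_Ring lb_ModuleSpace) lb_UniformSpace_mixin)
    little_bloch.

Definition lb_NormedModule_mixin : NormedModule.mixin_of C_AbsRing lb_NormedModuleAux.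
Proof.
  apply (NormedModule.Mixin C_AbsRing lb_NormedModuleAux
           (fun f : little_bloch => bloch_norm f) 1).
  - apply bloch_norm_triangle.
  - apply bloch_norm_scal.
  - intros f g eps H. exact H.
  - intros f g eps H. rewrite Rmult_1_l. exact H.
  - apply bloch_norm_eq_0.
Defined.

Canonical lb_NormedModule :=
  NormedModule.Pack C_AbsRing little_bloch
    (NormedModule.Class _ _ _ lb_NormedModule_mixin) little_bloch.

Record strongly_continuous_group {X : NormedModule C_AbsRing} (T : R -> X -> X)
  : Prop := {
  (* [is_linear] includes boundedness *)
  scg_linear : forall t : R, is_linear (T t);
  scg_0 : forall x : X, T 0 x = x;
  scg_plus : forall (s t : R) (x : X), T (s + t) x = T s (T t x);
  scg_continuous : forall (x : X) (t : R), continuous (fun s : R => T s x) t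
}.

Definition group_of_isometries {X : NormedModule C_AbsRing} (T : R -> X -> X) : Prop :=
  forall (t : R) (x : X), norm (T t x) = norm x.

(* [generator_graph T x y]: [x] is in the domain of the generator, with value [y];
   [locally' 0] is the punctured neighbourhood filter. *)
Definition generator_graph {X : NormedModule C_AbsRing} (T : R -> X -> X) (x y : X) : Prop :=
  filterlim (fun t : R => scal (RtoC (/ t) : C_AbsRing) (minus (T t x) x))
    (locally' 0) (locally y).

Definition generator_domain {X : NormedModule C_AbsRing} (T : R -> X -> X) (x : X) : Prop :=
  exists y : X, generator_graph T x y.

(* [cis theta] is e^{i theta} *)
Definition cis (theta : R) : C := (cos theta, sin theta).

(* Main.v *)
(* Differentiation commutes with the rotations up to a unimodular factor, so
   the Bloch norm is invariant.  Strong continuity: for f in the little Bloch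
   space, W(z) = (1 - |z|^2) f'(z) extended by 0 is continuous on the whole
   plane, hence uniformly continuous on the disc.  Generator: convergence of
   (T_t f - f) / t in norm implies pointwise convergence, which determines the
   limit g = i (c f + k z f') and forces z f' into the space.  Conversely, for
   such g, T_s g(z) is the s-derivative of T_s f(z), and likewise for the
   z-derivatives; the mean value inequality then bounds the norm of
   T_t f - f - t g by 4 |t| sup_{|s| <= |t|} |T_s g - g|. *)

Require Import Defs.
From Stdlib Require Import Reals Lra Psatz.
From Coquelicot Require Import Coquelicot.
Open Scope R_scope.

(** * Derivatives of complex power series *)

(** Analyticity is local power series representability, so regularity has to come out of the series
    themselves. The fact that carries the proof is that f' is again analytic: it makes f' Lipschitz
    at each interior point, which the continuity of W rests on, and it provides f'', which enters as
    soon as z f' is differentiated. The chain rule contributes a factor e^{ikt}, so f' is rotated in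
    the same way as f, with c + k in place of c; both summands of the Bloch norm are therefore
    handled by the same lemmas on curves s -> e^{ias} F(e^{iks} z). The constant 4 is 2 times 2: one
    factor from estimating real and imaginary parts separately by the real mean value theorem, the
    other from the two summands of the norm. Since z is fixed along such a curve, the weight is
    constant there, and the estimates become uniform in z. *)

Lemma is_C_derive_spec (f : C -> C) (z l : C) :
  @is_derive C_AbsRing C_NormedModule f z l <->
  forall eps : R, 0 < eps -> exists d : R, 0 < d /\
    forall y : C, Cmod (y - z) < d ->
      Cmod (f y - f z - (y - z) * l) <= eps * Cmod (y - z).
Proof.
  split.
  - intros [_ H] eps Heps.
    destruct (H z (fun P HP => HP) (mkposreal eps Heps)) as [d Hd].
    exists d. split; [apply cond_pos|]. intros y Hy. exact (Hd y Hy).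
  - intros H. split; [apply is_linear_scal_l|]. intros x Hx.
    apply (@is_filter_lim_locally_unique C_AbsRing
             (AbsRing_NormedModule C_AbsRing)) in Hx.
    subst x. intros eps.
    destruct (H eps (cond_pos eps)) as [d [Hd H']].
    exists (mkposreal d Hd). intros y Hy. exact (H' y Hy).
Qed.

Lemma pow_n_Cpow (z : C) (n : nat) : pow_n (z : C_AbsRing) n = (z ^ n)%C.
Proof.
  induction n as [|n IH]; [reflexivity|].
  simpl. rewrite IH. reflexivity.
Qed.

Lemma Cmod_series_le (a : nat -> C) (b : nat -> R) (l : C) (L : R) :
  (forall n, Cmod (a n) <= b n) ->
  @is_series C_AbsRing C_NormedModule a l ->
  @is_series R_AbsRing R_NormedModule b L -> Cmod l <= L.
Proof.
  intros Hab Ha Hb.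
  assert (H : is_lim_seq (fun n => Cmod (@sum_n C_NormedModule a n)) (Cmod l)).
  { eapply filterlim_comp; [exact Ha|].
    apply (@filterlim_norm C_AbsRing C_NormedModule). }
  refine (is_lim_seq_le _ _ (Finite _) (Finite _) _ H Hb).
  induction n as [|n IH].
  - rewrite !sum_O. apply Hab.
  - rewrite !sum_Sn. eapply Rle_trans; [apply Cmod_triangle|].
    now apply Rplus_le_compat.
Qed.

(** A term is the difference of two consecutive partial sums, and convergence bounds all partial
    sums by one constant; hence twice that constant bounds the terms. *)
Lemma pseries_coef_bound (a : nat -> C) (rho : R) (l : C) :
  0 <= rho -> @is_pseries C_AbsRing C_NormedModule a (RtoC rho) l ->
  exists M : R, forall n, Cmod (a n) * rho ^ n <= M.
Proof.
  intros Hrho H.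
  destruct (@filterlim_bounded C_AbsRing C_NormedModule _ (ex_intro _ _ H))
    as [M HM].
  set (t := fun n => scal (pow_n (RtoC rho : C_AbsRing) n) (a n : C_NormedModule)) in *.
  assert (Ht : forall n, Cmod (a n) * rho ^ n = Cmod (t n)).
  { intros n. unfold t. rewrite pow_n_Cpow.
    change (Cmod (a n) * rho ^ n = Cmod (RtoC rho ^ n * a n)).
    rewrite Cmod_mult, Cmod_pow, Cmod_R, Rabs_pos_eq by exact Hrho. ring. }
  assert (HM0 : 0 <= M).
  { eapply Rle_trans; [apply (@norm_ge_0 C_AbsRing C_NormedModule)|apply (HM 0%nat)]. }
  exists (2 * M). intros n. rewrite Ht. destruct n as [|n].
  - specialize (HM 0%nat). rewrite sum_O in HM. change (Cmod (t 0%nat) <= M) in HM. lra.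
  - assert (HS := HM (S n)). specialize (HM n). rewrite sum_Sn in HS.
    set (u := sum_n t n) in *.
    change (Cmod (u + t (S n)) <= M) in HS. change (Cmod u <= M) in HM.
    replace (t (S n)) with ((u + t (S n)) - u)%C by ring.
    eapply Rle_trans; [apply Cmod_triangle|]. rewrite Cmod_opp. lra.
Qed.

Lemma INR_S_le_pow (q : R) (n : nat) : 2 <= q -> INR (S n) <= q ^ n.
Proof.
  intros Hq. induction n as [|n IH]; [simpl; lra|].
  rewrite S_INR. simpl (q ^ S n).
  assert (H : 1 <= q ^ n) by (apply pow_R1_Rle; lra). nra.
Qed.

(** First-order Taylor remainder at [w] of the power with exponent n + 1. The shift makes the
    derivative (n + 1) w^n, in step with the indices of a differentiated power series. *)
Definition pow_remainder (v w : C) (n : nat) : C :=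
  (v ^ S n - w ^ S n - (v - w) * (RtoC (INR (S n)) * w ^ n))%C.

Lemma pow_remainder_S (v w : C) (n : nat) :
  pow_remainder v w (S n) =
  (v * pow_remainder v w n + RtoC (INR (S n)) * w ^ n * (v - w) ^ 2)%C.
Proof.
  unfold pow_remainder. rewrite (S_INR (S n)), RtoC_plus, !Cpow_S. ring.
Qed.

(** The recurrence gives quadratic smallness in [v - w] by induction. The factor 4^n is a crude
    majorant of the polynomial growth in [n], so that the remainders can be summed as a geometric
    series. *)
Lemma pow_remainder_le (v w : C) (s : R) (n : nat) :
  0 < s -> Cmod v <= s -> Cmod w <= s ->
  Cmod (pow_remainder v w n) <= (4 * s) ^ n * (Cmod (v - w) ^ 2 / s).
Proof.
  intros Hs Hv Hw. set (d := Cmod (v - w)).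
  assert (Hd : 0 <= d ^ 2) by (apply pow_le, Cmod_ge_0).
  induction n as [|n IH].
  - unfold pow_remainder.
    match goal with |- Cmod ?u <= _ => replace u with (RtoC 0) by (simpl; ring) end.
    rewrite Cmod_0. simpl. assert (0 <= d ^ 2 / s) by now apply Rdiv_le_0_compat.
    simpl in *. lra.
  - rewrite pow_remainder_S.
    eapply Rle_trans; [apply Cmod_triangle|].
    rewrite !Cmod_mult, !Cmod_pow, Cmod_R. fold d.
    rewrite Rabs_pos_eq by apply pos_INR.
    assert (H1 : Cmod v * Cmod (pow_remainder v w n)
                 <= s * ((4 * s) ^ n * (d ^ 2 / s))).
    { apply Rmult_le_compat; auto using Cmod_ge_0. }
    assert (H2 : INR (S n) * Cmod w ^ n <= 4 ^ n * s ^ n).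
    { apply Rmult_le_compat; [apply pos_INR|apply pow_le, Cmod_ge_0| |].
      - apply INR_S_le_pow; lra.
      - apply pow_incr. split; [apply Cmod_ge_0|exact Hw]. }
    apply (Rmult_le_compat_r _ _ _ Hd) in H2.
    assert (E1 : s * ((4 * s) ^ n * (d ^ 2 / s)) = 4 ^ n * s ^ n * d ^ 2).
    { rewrite Rpow_mult_distr. field. lra. }
    assert (E2 : (4 * s) ^ S n * (d ^ 2 / s) = 4 * (4 ^ n * s ^ n * d ^ 2)).
    { rewrite Rpow_mult_distr. simpl. field. lra. }
    assert (0 <= 4 ^ n * s ^ n * d ^ 2).
    { apply Rmult_le_pos; [|exact Hd]. apply Rmult_le_pos; apply pow_le; lra. }
    lra.
Qed.

Lemma is_series_half (K : R) :
  @is_series R_AbsRing R_NormedModule (fun n => K * (1 / 2) ^ n) (2 * K).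
Proof.
  replace (2 * K) with (K * / (1 - 1 / 2)) by field.
  apply (@is_series_scal_l R_AbsRing R_NormedModule).
  apply is_series_geom. rewrite Rabs_pos_eq; lra.
Qed.

(** Termwise differentiation. The differentiated series converges near [z0] to some [D]; then f y -
    f z - (y - z) D is the series of the a_{n+1} times [pow_remainder], hence of order |y - z|^2,
    which identifies [D] as f'(z). The radius shrinks from r to r/16. *)
Lemma analytic_C_derive (f : C -> C) (z0 : C) :
  analytic_at f z0 -> analytic_at (C_derive f) z0.
Proof.
  intros [a [r [Hr Hf]]].
  set (rho := r / 2). assert (Hrho : 0 < rho) by (unfold rho; lra).
  assert (HM : exists M, forall n, Cmod (a n) * rho ^ n <= M).
  { assert (Hz : Cmod (z0 + RtoC rho - z0) < r).
    { replace (z0 + RtoC rho - z0)%C with (RtoC rho) by ring.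
      rewrite Cmod_R, Rabs_pos_eq; unfold rho; lra. }
    specialize (Hf _ Hz).
    replace (z0 + RtoC rho - z0)%C with (RtoC rho) in Hf by ring.
    eapply pseries_coef_bound; [lra|exact Hf]. }
  destruct HM as [M HM].
  assert (HM0 : 0 <= M).
  { eapply Rle_trans; [|apply (HM 0%nat)]. simpl.
    assert (H := Cmod_ge_0 (a 0%nat)). lra. }
  (* With this choice 4 s = rho / 2, so the coefficient bound at radius [rho] dominates both series
     below by geometric series of ratio 1/2. *)
  set (s := rho / 8). assert (Hs : 0 < s) by (unfold s; lra).
  assert (Ha : forall n, Cmod (a (S n)) * (4 * s) ^ n <= M / rho * (1 / 2) ^ n).
  { intros n. replace (4 * s) with (rho * (1 / 2)) by (unfold s; field).
    rewrite Rpow_mult_distr, <- Rmult_assoc.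
    apply Rmult_le_compat_r; [apply pow_le; lra|].
    apply Rmult_le_reg_r with rho; [exact Hrho|].
    replace (M / rho * rho) with M by (field; lra).
    eapply Rle_trans; [|apply (HM (S n))]. simpl. lra. }
  exists (fun n => RtoC (INR (S n)) * a (S n))%C, s. split; [exact Hs|].
  intros z Hz. set (w := (z - z0)%C) in *.
  assert (Hex : @ex_series C_AbsRing C_CompleteNormedModule
            (fun n => scal (pow_n (w : C_AbsRing) n)
                           ((RtoC (INR (S n)) * a (S n))%C : C_NormedModule))).
  { apply ex_series_le with (fun n => M / rho * (1 / 2) ^ n).
    2: { eexists. apply is_series_half. }
    intros n. rewrite pow_n_Cpow.
    change (Cmod (w ^ n * (RtoC (INR (S n)) * a (S n))) <= M / rho * (1 / 2) ^ n).
    rewrite !Cmod_mult, Cmod_pow, Cmod_R, Rabs_pos_eq by apply pos_INR.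
    eapply Rle_trans; [|apply Ha]. rewrite Rpow_mult_distr.
    assert (H1 : INR (S n) <= 4 ^ n) by (apply INR_S_le_pow; lra).
    assert (H2 : Cmod w ^ n <= s ^ n)
      by (apply pow_incr; split; [apply Cmod_ge_0|lra]).
    assert (H3 : INR (S n) * Cmod w ^ n <= 4 ^ n * s ^ n).
    { apply Rmult_le_compat; auto using pos_INR, pow_le, Cmod_ge_0. }
    assert (H4 := Cmod_ge_0 (a (S n))). nra. }
  destruct Hex as [D HD].
  replace (C_derive f z) with D; [exact HD|].
  symmetry. apply is_C_derive_unique, is_C_derive_spec.
  intros eps Heps. set (K := 2 * (M / rho * / s)).
  assert (HK : 0 <= K).
  { unfold K. assert (0 <= M / rho) by now apply Rdiv_le_0_compat.
    assert (0 < / s) by now apply Rinv_0_lt_compat. nra. }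
  (* The first radius keeps [y] within distance [s] of [z0], where the remainder bound holds; the
     second turns K |y - z|^2 into at most eps |y - z|. *)
  exists (Rmin (s - Cmod w) (eps / (K + 1))). split.
  { apply Rmin_pos; [lra|]. apply Rdiv_lt_0_compat; lra. }
  intros y Hy.
  assert (Hy1 : Cmod (y - z) < s - Cmod w)
    by (eapply Rlt_le_trans; [exact Hy|apply Rmin_l]).
  assert (Hy2 : Cmod (y - z) < eps / (K + 1))
    by (eapply Rlt_le_trans; [exact Hy|apply Rmin_r]).
  set (v := (y - z0)%C).
  assert (Hvw : (y - z)%C = (v - w)%C) by (unfold v, w; ring).
  assert (Hv : Cmod v <= s).
  { replace v with ((y - z) + w)%C by (unfold v, w; ring).
    eapply Rle_trans; [apply Cmod_triangle|]. lra. }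
  assert (Hfy := Hf y). fold v in Hfy. specialize (Hfy ltac:(unfold s, rho in *; lra)).
  assert (Hfz := Hf z). fold w in Hfz. specialize (Hfz ltac:(unfold s, rho in *; lra)).
  assert (Hser : @is_series C_AbsRing C_NormedModule
            (fun n => (a (S n) * pow_remainder v w n)%C)
            (f y - f z - (y - z) * D)%C).
  { assert (H1 := is_series_minus _ _ _ _ Hfy Hfz).
    assert (H2 := @is_series_scal C_AbsRing C_NormedModule (v - w)%C _ _ HD).
    (* The constant terms of the two expansions cancel; dropping them aligns the indices with the
       differentiated series. *)
    match type of H1 with is_series ?u ?l =>
      assert (H3 : @is_series C_AbsRing C_NormedModule (fun n => u (S n)) l);
      [apply (@is_series_incr_1 C_AbsRing C_NormedModule u l);
       replace (plus l (u 0%nat)) with l; [exact H1|] |] end.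
    { change ((f y + - f z)%C
           = ((f y + - f z) + (RtoC 1 * a 0%nat + - (RtoC 1 * a 0%nat)))%C). ring. }
    assert (H4 := is_series_minus _ _ _ _ H3 H2).
    rewrite Hvw.
    eapply is_series_ext; [|exact H4].
    intros n. cbv beta. rewrite !pow_n_Cpow.
    change ((v ^ S n * a (S n) + - (w ^ S n * a (S n)))
            + - ((v - w) * (w ^ n * (RtoC (INR (S n)) * a (S n))))
            = a (S n) * pow_remainder v w n)%C.
    unfold pow_remainder. ring. }
  assert (Hle : Cmod (f y - f z - (y - z) * D)
                <= 2 * (M / rho * (Cmod (v - w) ^ 2 / s))).
  { eapply Cmod_series_le; [|exact Hser|apply is_series_half].
    intros n. cbv beta. rewrite Cmod_mult.
    assert (H1 := pow_remainder_le v w s n Hs Hv (Rlt_le _ _ Hz)).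
    assert (H2 := Cmod_ge_0 (a (S n))).
    assert (H3 : 0 <= Cmod (v - w) ^ 2 / s).
    { apply Rdiv_le_0_compat; [apply pow_le, Cmod_ge_0|exact Hs]. }
    specialize (Ha n).
    apply (Rmult_le_compat_l _ _ _ H2) in H1.
    apply (Rmult_le_compat_r _ _ _ H3) in Ha. lra. }
  eapply Rle_trans; [exact Hle|]. rewrite <- Hvw.
  set (d := Cmod (y - z)) in *.
  assert (Hd : 0 <= d) by apply Cmod_ge_0.
  replace (2 * (M / rho * (d ^ 2 / s))) with (K * d * d)
    by (unfold K; field; lra).
  apply Rmult_le_compat_r; [exact Hd|].
  apply Rmult_lt_compat_r with (r := K + 1) in Hy2; [|lra].
  unfold Rdiv in Hy2. rewrite Rmult_assoc, Rinv_l in Hy2 by lra. nra.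
Qed.

(** * Rotations on the little Bloch space *)

Lemma in_disc_near (z y : C) : Cmod (y - z) < 1 - Cmod z -> in_disc y.
Proof.
  intros H. unfold in_disc. replace y with ((y - z) + z)%C by ring.
  eapply Rle_lt_trans; [apply Cmod_triangle|]. lra.
Qed.

Lemma in_disc_0 : in_disc (RtoC 0).
Proof. unfold in_disc. rewrite Cmod_0. lra. Qed.

(** Expressions such as z f' are not known to vanish off the disc and enter [little_bloch] through a
    cut-off; this lemma and the next three show that the Bloch notions do not see it. Radii are cut
    to 1 - |z| to stay where the two functions agree. *)
Lemma analytic_on_disc_ext (f g : C -> C) :
  (forall z, in_disc z -> f z = g z) -> analytic_on_disc f -> analytic_on_disc g.
Proof.
  intros H Hf z Hz. destruct (Hf z Hz) as [a [r [Hr Ha]]].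
  exists a, (Rmin r (1 - Cmod z)). unfold in_disc in Hz. split.
  - apply Rmin_pos; lra.
  - intros y Hy.
    assert (Hr1 := Rmin_l r (1 - Cmod z)). assert (Hr2 := Rmin_r r (1 - Cmod z)).
    rewrite <- H by (apply in_disc_near with z; lra). apply Ha. lra.
Qed.

Lemma C_derive_ext_disc (f g : C -> C) (z : C) :
  (forall y, in_disc y -> f y = g y) -> analytic_on_disc f -> in_disc z ->
  C_derive g z = C_derive f z.
Proof.
  intros H Hf Hz. apply is_C_derive_unique, is_C_derive_spec.
  intros eps Heps.
  destruct (proj1 (is_C_derive_spec f z _) (analytic_is_derive f z (Hf z Hz)) eps Heps)
    as [d [Hd H1]].
  exists (Rmin d (1 - Cmod z)). unfold in_disc in Hz. split.
  - apply Rmin_pos; lra.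
  - intros y Hy.
    assert (Hr1 := Rmin_l d (1 - Cmod z)). assert (Hr2 := Rmin_r d (1 - Cmod z)).
    rewrite <- !H by (try exact Hz; apply in_disc_near with z; lra). apply H1. lra.
Qed.

Lemma bloch_weight_ext (f g : C -> C) (z : C) :
  (forall y, in_disc y -> f y = g y) -> analytic_on_disc f -> in_disc z ->
  bloch_weight g z = bloch_weight f z.
Proof.
  intros H Hf Hz. unfold bloch_weight. now rewrite (C_derive_ext_disc f g).
Qed.

Lemma in_little_bloch_ext (f g : C -> C) :
  (forall z, in_disc z -> f z = g z) -> in_little_bloch f -> in_little_bloch g.
Proof.
  intros H [[Hf [M HM]] Lf]. split; [split|].
  - now apply analytic_on_disc_ext with f.
  - exists M. intros z Hz. rewrite (bloch_weight_ext f g) by auto. auto.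
  - intros eps Heps. destruct (Lf eps Heps) as [r [Hr Hr']].
    exists r. split; [exact Hr|]. intros z Hz.
    rewrite (bloch_weight_ext f g) by (auto; apply Hz). auto.
Qed.

Lemma lb_of_out (F : C -> C) (z : C) :
  ~ in_disc z -> (if Rlt_dec (Cmod z) 1 then F z else RtoC 0) = RtoC 0.
Proof. intros Hz. now destruct (Rlt_dec (Cmod z) 1). Qed.

Lemma lb_of_in (F : C -> C) :
  in_little_bloch F ->
  in_little_bloch (fun z => if Rlt_dec (Cmod z) 1 then F z else RtoC 0).
Proof.
  apply in_little_bloch_ext. intros z Hz. now destruct (Rlt_dec (Cmod z) 1).
Qed.

Definition lb_of (F : C -> C) (HF : in_little_bloch F) : little_bloch :=
  LittleBloch _ (lb_of_in F HF) (lb_of_out F).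

Lemma lb_ofE (F : C -> C) (HF : in_little_bloch F) (z : C) :
  in_disc z -> lb_of F HF z = F z.
Proof. intros Hz. simpl. now destruct (Rlt_dec (Cmod z) 1). Qed.

Lemma lb_analytic (f : little_bloch) : analytic_on_disc f.
Proof. apply lb_in. Qed.

Lemma Cmod_unit_mult (u z : C) : Cmod u = 1 -> Cmod (u * z) = Cmod z.
Proof. intros Hu. rewrite Cmod_mult, Hu. ring. Qed.

Lemma in_disc_rotate (u z : C) : Cmod u = 1 -> in_disc z -> in_disc (u * z)%C.
Proof. intros Hu Hz. unfold in_disc. now rewrite Cmod_unit_mult. Qed.

Lemma analytic_rotate (f : C -> C) (u z : C) :
  Cmod u = 1 -> analytic_at f (u * z)%C -> analytic_at (fun y => f (u * y)%C) z.
Proof.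
  intros Hu [a [r [Hr Ha]]].
  exists (fun n => u ^ n * a n)%C, r. split; [exact Hr|].
  intros y Hy.
  assert (E : (u * y - u * z)%C = (u * (y - z))%C) by ring.
  assert (H := Ha (u * y)%C). rewrite E, Cmod_unit_mult in H by exact Hu.
  eapply is_series_ext; [|exact (H Hy)].
  intros n. cbv beta. rewrite !pow_n_Cpow.
  change ((u * (y - z)) ^ n * a n = (y - z) ^ n * (u ^ n * a n))%C.
  rewrite Cpow_mult_l. ring.
Qed.

Lemma C_derive_rotate (f : C -> C) (u z : C) :
  Cmod u = 1 -> analytic_at f (u * z)%C ->
  C_derive (fun y => f (u * y)%C) z = (u * C_derive f (u * z))%C.
Proof.
  intros Hu Hf. apply is_C_derive_unique, is_C_derive_spec.
  intros eps Heps.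
  destruct (proj1 (is_C_derive_spec f _ _) (analytic_is_derive f _ Hf) eps Heps)
    as [d [Hd H]].
  exists d. split; [exact Hd|]. intros y Hy.
  assert (E : (u * y - u * z)%C = (u * (y - z))%C) by ring.
  specialize (H (u * y)%C). rewrite E, Cmod_unit_mult in H by exact Hu.
  replace ((y - z) * (u * C_derive f (u * z)))%C
    with (u * (y - z) * C_derive f (u * z))%C by ring. auto.
Qed.

Lemma bloch_weight_rotate (f : C -> C) (u z : C) :
  Cmod u = 1 -> analytic_on_disc f -> in_disc z ->
  bloch_weight (fun y => f (u * y)%C) z = bloch_weight f (u * z)%C.
Proof.
  intros Hu Hf Hz. unfold bloch_weight.
  rewrite C_derive_rotate by auto using in_disc_rotate.
  now rewrite !Cmod_unit_mult.
Qed.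

Lemma in_little_bloch_rotate (f : C -> C) (u : C) :
  Cmod u = 1 -> in_little_bloch f -> in_little_bloch (fun y => f (u * y)%C).
Proof.
  intros Hu [[Hf [M HM]] Lf]. split; [split|].
  - intros z Hz. apply analytic_rotate; auto using in_disc_rotate.
  - exists M. intros z Hz. rewrite bloch_weight_rotate by auto.
    auto using in_disc_rotate.
  - intros eps Heps. destruct (Lf eps Heps) as [r [Hr Hr']].
    exists r. split; [exact Hr|]. intros z Hz.
    rewrite bloch_weight_rotate by (auto; apply Hz).
    apply Hr'. now rewrite Cmod_unit_mult.
Qed.

Lemma Cmod_cis (x : R) : Cmod (cis x) = 1.
Proof.
  unfold Cmod, cis, fst, snd. rewrite <- !Rsqr_pow2, Rplus_comm, sin2_cos2.
  apply sqrt_1.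
Qed.

Lemma cis_plus (x y : R) : cis (x + y) = (cis x * cis y)%C.
Proof.
  unfold cis, Cmult, fst, snd. rewrite cos_plus, sin_plus.
  f_equal; ring.
Qed.

Lemma cis_0 : cis 0 = RtoC 1.
Proof. unfold cis, RtoC. now rewrite cos_0, sin_0. Qed.

Lemma Cmod_le_sum (w : C) : Cmod w <= Rabs (fst w) + Rabs (snd w).
Proof.
  unfold Cmod. apply Rsqr_incr_0_var.
  - rewrite Rsqr_sqrt by (assert (0 <= fst w ^ 2) by apply pow2_ge_0;
      assert (0 <= snd w ^ 2) by apply pow2_ge_0; lra).
    rewrite <- (pow2_abs (fst w)), <- (pow2_abs (snd w)). unfold Rsqr.
    assert (H1 := Rabs_pos (fst w)). assert (H2 := Rabs_pos (snd w)). nra.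
  - assert (H1 := Rabs_pos (fst w)). assert (H2 := Rabs_pos (snd w)). lra.
Qed.

Lemma im_le_Cmod (w : C) : Rabs (snd w) <= Cmod w.
Proof. eapply Rle_trans; [apply Rmax_r|apply Rmax_Cmod]. Qed.

(** The factor 2 comes from adding the real and imaginary parts, each at most |x| because sin and
    cos are bounded by 1. *)
Lemma Cmod_cis_minus_1 (x : R) : Cmod (cis x - RtoC 1) <= 2 * Rabs x.
Proof.
  assert (H1 : Rabs (cos x - cos 0) <= 1 * Rabs (x - 0)).
  { apply bounded_variation with (fun t => - sin t). intros t _. split.
    - auto_derive; [exact I|ring].
    - rewrite Rabs_Ropp. apply Rabs_le, SIN_bound. }
  assert (H2 : Rabs (sin x - sin 0) <= 1 * Rabs (x - 0)).
  { apply bounded_variation with cos. intros t _. split.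
    - auto_derive; [exact I|ring].
    - apply Rabs_le, COS_bound. }
  rewrite cos_0, Rminus_0_r in H1. rewrite sin_0, !Rminus_0_r in H2.
  eapply Rle_trans; [apply Cmod_le_sum|].
  unfold cis. cbn -[Rabs]. rewrite Ropp_0, Rplus_0_r. unfold Rminus in *. lra.
Qed.

Lemma lb_minusE (f g : little_bloch) (z : C) : minus f g z = (f z - g z)%C.
Proof. change (f z + (- RtoC 1) * g z = f z - g z)%C. ring. Qed.

Lemma C_derive_lb_minus (f g : little_bloch) (z : C) : in_disc z ->
  C_derive (minus f g) z = (C_derive f z - C_derive g z)%C.
Proof.
  intros Hz. change (C_derive (fun z => f z + (- RtoC 1) * g z)%C z
                     = C_derive f z - C_derive g z)%C.
  rewrite C_derive_plus, C_derive_scal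
    by (try apply analytic_scal; now apply lb_analytic). ring.
Qed.

Lemma bloch_norm_le (f : little_bloch) (A B : R) :
  Cmod (f (RtoC 0)) <= A -> (forall z, in_disc z -> bloch_weight f z <= B) ->
  bloch_norm f <= A + B.
Proof.
  intros HA HB. apply Rplus_le_compat; [exact HA|].
  apply bloch_sup_le; [apply lb_in|exact HB].
Qed.

Lemma bloch_weight_le_norm (f : little_bloch) (z : C) :
  in_disc z -> bloch_weight f z <= bloch_norm f.
Proof.
  intros Hz. assert (H := bloch_weight_le_sup f z (lb_in f) Hz).
  assert (H0 := Cmod_ge_0 (f (RtoC 0))). unfold bloch_norm. lra.
Qed.

Lemma Cmod_0_le_norm (f : little_bloch) : Cmod (f (RtoC 0)) <= bloch_norm f.
Proof.
  assert (H := bloch_sup_ge_0 f (lb_in f)). unfold bloch_norm. lra.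
Qed.

Definition rotation_group (c k t : R) (f : little_bloch) : little_bloch :=
  lb_of (fun z => cis (c * t) * f (cis (k * t) * z))%C
    (in_little_bloch_scal _ _
       (in_little_bloch_rotate _ _ (Cmod_cis (k * t)) (lb_in f))).

Lemma rotation_groupE (c k t : R) (f : little_bloch) (z : C) :
  in_disc z -> rotation_group c k t f z = (cis (c * t) * f (cis (k * t) * z))%C.
Proof. intros Hz. unfold rotation_group. now rewrite lb_ofE. Qed.

(** The chain-rule factor e^{ikt} merges with e^{ict}: f' is rotated by the same formula with
    [c + k] in place of [c]. *)
Lemma C_derive_rotation_group (c k t : R) (f : little_bloch) (z : C) :
  in_disc z ->
  C_derive (rotation_group c k t f) z =
  (cis ((c + k) * t) * C_derive f (cis (k * t) * z))%C.
Proof.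
  intros Hz.
  assert (Hr : analytic_on_disc (fun y => f (cis (k * t) * y)%C)).
  { intros y Hy. apply analytic_rotate; [apply Cmod_cis|].
    apply lb_analytic, in_disc_rotate; [apply Cmod_cis|exact Hy]. }
  rewrite (C_derive_ext_disc (fun y => cis (c * t) * f (cis (k * t) * y))%C).
  - rewrite C_derive_scal by (now apply Hr).
    rewrite (C_derive_rotate f _ z (Cmod_cis _))
      by (apply lb_analytic, in_disc_rotate; auto using Cmod_cis).
    replace ((c + k) * t) with (c * t + k * t) by ring. rewrite cis_plus. ring.
  - intros y Hy. symmetry. now apply rotation_groupE.
  - intros y Hy. apply analytic_scal. now apply Hr.
  - exact Hz.
Qed.

Lemma rotation_group_0 (c k : R) (f : little_bloch) : rotation_group c k 0 f = f.
Proof.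
  apply little_bloch_ext. intros z Hz. rewrite rotation_groupE by exact Hz.
  rewrite !Rmult_0_r, cis_0, !Cmult_1_l. reflexivity.
Qed.

Lemma rotation_group_plus (c k s t : R) (f : little_bloch) :
  rotation_group c k (s + t) f = rotation_group c k s (rotation_group c k t f).
Proof.
  apply little_bloch_ext. intros z Hz.
  rewrite !rotation_groupE by (auto using in_disc_rotate, Cmod_cis).
  rewrite !Rmult_plus_distr_l, !cis_plus, !Cmult_assoc.
  f_equal. f_equal. ring.
Qed.

Lemma bloch_norm_rotation_group_le (c k t : R) (f : little_bloch) :
  bloch_norm (rotation_group c k t f) <= bloch_norm f.
Proof.
  apply bloch_norm_le.
  - rewrite rotation_groupE by apply in_disc_0.
    rewrite Cmod_unit_mult, Cmult_0_r by apply Cmod_cis. apply Rle_refl.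
  - intros z Hz. unfold bloch_weight.
    rewrite C_derive_rotation_group, Cmod_unit_mult by (auto using Cmod_cis).
    rewrite <- (Cmod_unit_mult (cis (k * t)) z) at 1 by apply Cmod_cis.
    apply (bloch_weight_le_sup f _ (lb_in f)).
    apply in_disc_rotate; [apply Cmod_cis|exact Hz].
Qed.

(** The reverse inequality is the contraction bound at time [- t], applied to T_t f. *)
Lemma bloch_norm_rotation_group (c k t : R) (f : little_bloch) :
  bloch_norm (rotation_group c k t f) = bloch_norm f.
Proof.
  apply Rle_antisym; [apply bloch_norm_rotation_group_le|].
  rewrite <- (rotation_group_0 c k f) at 1. replace 0 with (- t + t) by ring.
  rewrite rotation_group_plus. apply bloch_norm_rotation_group_le.
Qed.

Lemma is_linear_rotation_group (c k t : R) :
  @is_linear C_AbsRing lb_NormedModule lb_NormedModule (rotation_group c k t).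
Proof.
  split.
  - intros f g. apply little_bloch_ext. intros z Hz.
    change (rotation_group c k t (lb_plus f g) z =
            (rotation_group c k t f z + rotation_group c k t g z)%C).
    rewrite !rotation_groupE by exact Hz. simpl. ring.
  - intros l f. apply little_bloch_ext. intros z Hz.
    change (rotation_group c k t (lb_scal l f) z =
            (l * rotation_group c k t f z)%C).
    rewrite !rotation_groupE by exact Hz. simpl. ring.
  - exists 1. split; [lra|]. intros f. rewrite Rmult_1_l.
    apply bloch_norm_rotation_group_le.
Qed.

(** * Strong continuity *)

Lemma is_C_derive_lipschitz (f : C -> C) (z l : C) :
  @is_derive C_AbsRing C_NormedModule f z l ->
  exists L d : R, 0 < L /\ 0 < d /\
    forall y, Cmod (y - z) < d -> Cmod (f y - f z) <= L * Cmod (y - z).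
Proof.
  intros H. destruct (proj1 (is_C_derive_spec f z l) H 1 Rlt_0_1) as [d [Hd H']].
  exists (1 + Cmod l), d. assert (Hl := Cmod_ge_0 l).
  split; [lra|split; [exact Hd|]]. intros y Hy. specialize (H' y Hy).
  replace (f y - f z)%C with ((f y - f z - (y - z) * l) + (y - z) * l)%C by ring.
  eapply Rle_trans; [apply Cmod_triangle|]. rewrite Cmod_mult. lra.
Qed.

Definition weighted_derive (f : C -> C) (z : C) : C :=
  if Rlt_dec (Cmod z) 1 then (RtoC (1 - Cmod z ^ 2) * C_derive f z)%C else RtoC 0.

Lemma weighted_deriveE (f : C -> C) (z : C) :
  in_disc z -> weighted_derive f z = (RtoC (1 - Cmod z ^ 2) * C_derive f z)%C.
Proof. intros Hz. unfold weighted_derive. now destruct (Rlt_dec (Cmod z) 1). Qed.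

Lemma Cmod_weighted_derive (f : C -> C) (z : C) :
  in_disc z -> Cmod (weighted_derive f z) = bloch_weight f z.
Proof.
  intros Hz. rewrite weighted_deriveE by exact Hz.
  rewrite Cmod_mult, Cmod_R, Rabs_pos_eq by (apply Rlt_le, disc_weight_pos, Hz).
  reflexivity.
Qed.

Lemma Cmod_sub_sym (u v : C) : Cmod (u - v) = Cmod (v - u).
Proof. rewrite <- Cmod_opp. f_equal. ring. Qed.

Lemma Cmod_rev_triangle (u v : C) : Rabs (Cmod u - Cmod v) <= Cmod (u - v).
Proof.
  assert (H1 := Cmod_triangle (u - v) v). assert (H2 := Cmod_triangle (v - u) u).
  rewrite (Cmod_sub_sym v u) in H2.
  replace (u - v + v)%C with u in H1 by ring.
  replace (v - u + u)%C with v in H2 by ring.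
  apply Rabs_le. lra.
Qed.

(* At boundary points continuity is exactly the little Bloch condition. *)
Lemma weighted_derive_continuous (f : C -> C) (z : C) (eps : R) :
  in_little_bloch f -> 0 < eps ->
  exists d : R, 0 < d /\ forall y, Cmod (y - z) < d ->
    Cmod (weighted_derive f y - weighted_derive f z) < eps.
Proof.
  intros Hf Heps. destruct (Rlt_dec (Cmod z) 1) as [Hz|Hz].
  - destruct (is_C_derive_lipschitz (C_derive f) z (C_derive (C_derive f) z))
      as [L [d [HL [Hd HLd]]]].
    { apply analytic_is_derive, analytic_C_derive, (proj1 (proj1 Hf)), Hz. }
    (* Local Lipschitz constant of the product: [L] from f', and 2 |f'(z)| from the weight, since
       |z|^2 - |y|^2 is at most 2 |y - z| in modulus on the disc. *)
    set (N := L + 2 * Cmod (C_derive f z)).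
    assert (Hn := Cmod_ge_0 (C_derive f z)).
    exists (Rmin (Rmin d (1 - Cmod z)) (eps / N)). split.
    { repeat apply Rmin_pos; try lra. apply Rdiv_lt_0_compat; unfold N; lra. }
    intros y Hy.
    assert (H1 := Rmin_l (Rmin d (1 - Cmod z)) (eps / N)).
    assert (H2 := Rmin_r (Rmin d (1 - Cmod z)) (eps / N)).
    assert (H3 := Rmin_l d (1 - Cmod z)). assert (H4 := Rmin_r d (1 - Cmod z)).
    assert (Hyd : in_disc y) by (apply in_disc_near with z; lra).
    rewrite !weighted_deriveE by assumption.
    specialize (HLd y ltac:(lra)).
    replace (RtoC (1 - Cmod y ^ 2) * C_derive f y - RtoC (1 - Cmod z ^ 2) * C_derive f z)%C
      with (RtoC (1 - Cmod y ^ 2) * (C_derive f y - C_derive f z)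
            + RtoC (Cmod z ^ 2 - Cmod y ^ 2) * C_derive f z)%C
      by (rewrite !RtoC_minus; ring).
    eapply Rle_lt_trans; [apply Cmod_triangle|].
    rewrite !Cmod_mult, !Cmod_R.
    assert (Hy0 := Cmod_ge_0 y). assert (Hz0 := Cmod_ge_0 z). unfold in_disc in Hyd.
    assert (Ha : Rabs (1 - Cmod y ^ 2) <= 1) by (apply Rabs_le; nra).
    assert (Hb : Rabs (Cmod z ^ 2 - Cmod y ^ 2) <= 2 * Cmod (y - z)).
    { replace (Cmod z ^ 2 - Cmod y ^ 2)
        with ((Cmod y + Cmod z) * (Cmod z - Cmod y)) by ring.
      rewrite Rabs_mult, (Rabs_pos_eq (_ + _)) by lra.
      apply Rmult_le_compat; try lra; [apply Rabs_pos|].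
      rewrite (Cmod_sub_sym y z). apply Cmod_rev_triangle. }
    apply Rle_lt_trans with (N * Cmod (y - z)).
    + assert (Hc := Cmod_ge_0 (C_derive f y - C_derive f z)).
      apply (Rmult_le_compat_r _ _ _ Hc) in Ha.
      apply (Rmult_le_compat_r _ _ _ Hn) in Hb. unfold N. lra.
    + replace eps with (N * (eps / N)) by (field; unfold N; lra).
      apply Rmult_lt_compat_l; [unfold N|]; lra.
  - destruct (proj2 Hf eps Heps) as [r [Hr Hr']].
    (* As |z| >= 1, this distance forces |y| > r, so inside the disc the little Bloch bound applies
       to [y]. *)
    exists (1 - r). split; [lra|]. intros y Hy.
    replace (weighted_derive f z) with (RtoC 0)
      by (unfold weighted_derive; now destruct (Rlt_dec (Cmod z) 1)).
    replace (weighted_derive f y - RtoC 0)%C with (weighted_derive f y) by ring.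
    destruct (Rlt_dec (Cmod y) 1) as [Hy1|Hy1].
    + rewrite Cmod_weighted_derive by exact Hy1. apply Hr'. split; [|exact Hy1].
      assert (H := Cmod_rev_triangle y z). apply Rabs_le_between in H. lra.
    + unfold weighted_derive. destruct (Rlt_dec (Cmod y) 1); [contradiction|].
      now rewrite Cmod_0.
Qed.

(** Heine's theorem for a real function of two real variables on the square [-1, 1]^2, which
    contains the disc. The square has points on and outside the unit circle, which is why continuity
    of [W] is assumed on the whole plane; [p] stands for the real or the imaginary part. *)
Lemma component_uniformly_continuous (p : C -> R) (W : C -> C) (eps : R) :
  (forall u v : C, Rabs (p u - p v) <= Cmod (u - v)) ->
  (forall (z : C) (e : R), 0 < e -> exists d : R, 0 < d /\
     forall y, Cmod (y - z) < d -> Cmod (W y - W z) < e) ->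
  0 < eps -> exists d : R, 0 < d /\
    forall y z, in_disc y -> in_disc z -> Cmod (y - z) < d ->
      Rabs (p (W y) - p (W z)) < eps.
Proof.
  intros Hp HW Heps.
  destruct (uniform_continuity_2d (fun a b => p (W (a, b))) (-1) 1 (-1) 1)
    with (eps := mkposreal eps Heps) as [d Hd].
  { intros a b _ _ e. destruct (HW (a, b) e (cond_pos e)) as [d [Hd H]].
    assert (Hd2 : 0 < d / 2) by lra.
    exists (mkposreal _ Hd2). simpl. intros u v Hu Hv.
    eapply Rle_lt_trans; [apply Hp|]. apply H.
    eapply Rle_lt_trans; [apply Cmod_le_sum|].
    change (Rabs (u - a) + Rabs (v - b) < d). lra. }
  exists d. split; [apply cond_pos|]. intros [u v] [a b] Hy Hz H.
  unfold in_disc in Hy, Hz.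
  assert (B : forall w : C, Cmod w < 1 -> -1 <= fst w <= 1 /\ -1 <= snd w <= 1).
  { intros w Hw. split; apply Rabs_le_between.
    - assert (H1 := re_le_Cmod w). unfold Re in H1. lra.
    - assert (H1 := im_le_Cmod w). lra. }
  destruct (B _ Hy) as [B1 B2]. destruct (B _ Hz) as [B3 B4]. simpl in *.
  apply Hd; try assumption.
  - eapply Rle_lt_trans; [apply (re_le_Cmod ((u, v) - (a, b)))|exact H].
  - eapply Rle_lt_trans; [apply (im_le_Cmod ((u, v) - (a, b)))|exact H].
Qed.

Lemma re_lipschitz (u v : C) : Rabs (fst u - fst v) <= Cmod (u - v).
Proof. apply (re_le_Cmod (u - v)). Qed.

Lemma im_lipschitz (u v : C) : Rabs (snd u - snd v) <= Cmod (u - v).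
Proof. apply (im_le_Cmod (u - v)). Qed.

Lemma weighted_derive_uniformly_continuous (f : C -> C) (eps : R) :
  in_little_bloch f -> 0 < eps ->
  exists d : R, 0 < d /\
    forall y z, in_disc y -> in_disc z -> Cmod (y - z) < d ->
      Cmod (weighted_derive f y - weighted_derive f z) < eps.
Proof.
  intros Hf Heps.
  assert (HW := fun z e => weighted_derive_continuous f z e Hf).
  assert (Heps2 : 0 < eps / 2) by lra.
  destruct (component_uniformly_continuous fst _ _ re_lipschitz HW Heps2)
    as [d1 [Hd1 H1]].
  destruct (component_uniformly_continuous snd _ _ im_lipschitz HW Heps2)
    as [d2 [Hd2 H2]].
  exists (Rmin d1 d2). split; [now apply Rmin_pos|]. intros y z Hy Hz H.
  assert (M1 := Rmin_l d1 d2). assert (M2 := Rmin_r d1 d2).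
  specialize (H1 y z Hy Hz ltac:(lra)). specialize (H2 y z Hy Hz ltac:(lra)).
  eapply Rle_lt_trans; [apply Cmod_le_sum|].
  set (a := weighted_derive f y) in *. set (b := weighted_derive f z) in *.
  change (Rabs (fst a - fst b) + Rabs (snd a - snd b) < eps). lra.
Qed.

Lemma cis_near_1 (a eps : R) : 0 < eps ->
  exists d : R, 0 < d /\ forall t, Rabs t < d -> Cmod (cis (a * t) - RtoC 1) < eps.
Proof.
  intros Heps. assert (Ha := Rabs_pos a).
  exists (eps / (2 * (Rabs a + 1))). split; [apply Rdiv_lt_0_compat; lra|].
  intros t Ht. eapply Rle_lt_trans; [apply Cmod_cis_minus_1|].
  rewrite Rabs_mult.
  apply Rmult_lt_compat_r with (r := 2 * (Rabs a + 1)) in Ht; [|lra].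
  unfold Rdiv in Ht. rewrite Rmult_assoc, Rinv_l in Ht by lra.
  assert (H := Rabs_pos t). nra.
Qed.

(** With W the weighted derivative, u = e^{ikt} and l = e^{i(c+k)t}, the weighted derivative of T_t
    f - f is l (W(uz) - W(z)) + (l - 1) W(z), because |uz| = |z|. The first term is small by uniform
    continuity, as |uz - z| <= |u - 1|; the second because |W| is at most the norm of f. *)
Lemma rotation_group_near_0 (c k : R) (f : little_bloch) (eps : R) : 0 < eps ->
  exists d : R, 0 < d /\ forall t, Rabs t < d ->
    bloch_norm (minus (rotation_group c k t f) f) < eps.
Proof.
  intros Heps. set (S := bloch_norm f). assert (HS := bloch_norm_ge_0 f). fold S in HS.
  (* The value at 0 and the term with l - 1 cost at most [e / 2 * S] each, together less than eps/2,
     on top of the eps/4 from uniform continuity. The 1 avoids division by 0 when the norm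
     vanishes. *)
  set (e := eps / (2 * (S + 1))).
  assert (He : 0 < e) by (apply Rdiv_lt_0_compat; lra).
  assert (Heps4 : 0 < eps / 4) by lra.
  destruct (weighted_derive_uniformly_continuous f _ (lb_in f) Heps4)
    as [d0 [Hd0 H0]].
  destruct (cis_near_1 c (e / 2)) as [d1 [Hd1 H1]]; [lra|].
  destruct (cis_near_1 (c + k) (e / 2)) as [d2 [Hd2 H2]]; [lra|].
  destruct (cis_near_1 k d0 Hd0) as [d3 [Hd3 H3]].
  exists (Rmin d1 (Rmin d2 d3)). split; [now repeat apply Rmin_pos|].
  intros t Ht.
  assert (M1 := Rmin_l d1 (Rmin d2 d3)). assert (M2 := Rmin_r d1 (Rmin d2 d3)).
  assert (M3 := Rmin_l d2 d3). assert (M4 := Rmin_r d2 d3).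
  specialize (H1 t ltac:(lra)). specialize (H2 t ltac:(lra)).
  specialize (H3 t ltac:(lra)).
  assert (He' : e * (2 * (S + 1)) = eps) by (unfold e; field; lra).
  apply Rle_lt_trans with (e / 2 * S + (eps / 4 + e / 2 * S)); [|nra].
  apply bloch_norm_le.
  - rewrite lb_minusE, rotation_groupE, Cmult_0_r by apply in_disc_0.
    replace (cis (c * t) * f (RtoC 0) - f (RtoC 0))%C
      with ((cis (c * t) - RtoC 1) * f (RtoC 0))%C by ring.
    rewrite Cmod_mult. apply Rmult_le_compat; try apply Cmod_ge_0; [lra|].
    apply Cmod_0_le_norm.
  - intros z Hz. set (u := cis (k * t)) in *. set (l := cis ((c + k) * t)) in *.
    assert (Hu : Cmod u = 1) by apply Cmod_cis.
    assert (Hl : Cmod l = 1) by apply Cmod_cis.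
    assert (Huz : in_disc (u * z)%C) by now apply in_disc_rotate.
    rewrite <- Cmod_weighted_derive, weighted_deriveE by exact Hz.
    rewrite C_derive_lb_minus, C_derive_rotation_group by exact Hz.
    fold u l.
    replace (RtoC (1 - Cmod z ^ 2) * (l * C_derive f (u * z) - C_derive f z))%C
      with (l * (weighted_derive f (u * z) - weighted_derive f z)
            + (l - RtoC 1) * weighted_derive f z)%C.
    2: { rewrite !weighted_deriveE, Cmod_unit_mult by assumption. ring. }
    eapply Rle_trans; [apply Cmod_triangle|].
    rewrite Cmod_unit_mult by exact Hl. rewrite Cmod_mult.
    apply Rplus_le_compat.
    + apply Rlt_le, H0; [exact Huz|exact Hz|].
      replace (u * z - z)%C with ((u - RtoC 1) * z)%C by ring.
      rewrite Cmod_mult. unfold in_disc in Hz.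
      assert (P1 := Cmod_ge_0 z). assert (P2 := Cmod_ge_0 (u - RtoC 1)). nra.
    + apply Rmult_le_compat; try apply Cmod_ge_0; [lra|].
      rewrite Cmod_weighted_derive by exact Hz. now apply bloch_weight_le_norm.
Qed.

(** This is T_s - T_t = T_t (T_{s-t} - I). As T_t is an isometry, it reduces continuity at [t] to
    continuity at 0. *)
Lemma rotation_group_minus (c k s t : R) (f : little_bloch) :
  minus (rotation_group c k s f) (rotation_group c k t f)
  = rotation_group c k t (minus (rotation_group c k (s - t) f) f).
Proof.
  replace s with (t + (s - t)) at 1 by ring. rewrite rotation_group_plus.
  apply little_bloch_ext. intros z Hz.
  rewrite lb_minusE, (rotation_groupE c k t (rotation_group c k (s - t) f)),
    (rotation_groupE c k t f), (rotation_groupE c k t (minus _ _)), lb_minusE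
    by exact Hz. ring.
Qed.

Lemma rotation_group_strongly_continuous (c k : R) :
  @strongly_continuous_group lb_NormedModule (rotation_group c k).
Proof.
  split.
  - apply is_linear_rotation_group.
  - apply rotation_group_0.
  - apply rotation_group_plus.
  - intros f t. apply filterlim_locally. intros eps.
    destruct (rotation_group_near_0 c k f eps (cond_pos eps)) as [d [Hd H]].
    exists (mkposreal d Hd). intros s Hs.
    change (bloch_norm (minus (rotation_group c k s f) (rotation_group c k t f)) < eps).
    rewrite rotation_group_minus, bloch_norm_rotation_group. apply H, Hs.
Qed.

(** * Curves in the complex plane *)

(** Taken componentwise, so that the real product rule and the real mean value theorem apply
    directly; [is_curve_derive_spec] recovers the estimate in modulus. *)
Definition is_curve_derive (g : R -> C) (t : R) (l : C) : Prop :=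
  is_derive (fun s => fst (g s)) t (fst l) /\ is_derive (fun s => snd (g s)) t (snd l).

Lemma is_derive_spec (g : R -> R) (t l : R) :
  is_derive g t l <->
  forall eps : R, 0 < eps -> exists d : R, 0 < d /\ forall s, Rabs (s - t) < d ->
    Rabs (g s - g t - (s - t) * l) <= eps * Rabs (s - t).
Proof.
  split.
  - intros [_ H] eps Heps.
    destruct (H t (fun P HP => HP) (mkposreal eps Heps)) as [d Hd].
    exists d. split; [apply cond_pos|]. intros y Hy. exact (Hd y Hy).
  - intros H. split; [apply is_linear_scal_l|]. intros x Hx.
    apply (@is_filter_lim_locally_unique R_AbsRing
             (AbsRing_NormedModule R_AbsRing)) in Hx.
    subst x. intros eps.
    destruct (H eps (cond_pos eps)) as [d [Hd H']].
    exists (mkposreal d Hd). intros y Hy. exact (H' y Hy).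
Qed.

Lemma is_curve_derive_spec (g : R -> C) (t : R) (l : C) :
  is_curve_derive g t l <->
  forall eps : R, 0 < eps -> exists d : R, 0 < d /\ forall s, Rabs (s - t) < d ->
    Cmod (g s - g t - RtoC (s - t) * l) <= eps * Rabs (s - t).
Proof.
  assert (E1 : forall s, fst (g s - g t - RtoC (s - t) * l)%C
                         = fst (g s) - fst (g t) - (s - t) * fst l)
    by (intros s; simpl; ring).
  assert (E2 : forall s, snd (g s - g t - RtoC (s - t) * l)%C
                         = snd (g s) - snd (g t) - (s - t) * snd l)
    by (intros s; simpl; ring).
  unfold is_curve_derive. rewrite !is_derive_spec. split.
  - intros [H1 H2] eps Heps.
    destruct (H1 (eps / 2)) as [d1 [Hd1 H1']]; [lra|].
    destruct (H2 (eps / 2)) as [d2 [Hd2 H2']]; [lra|].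
    exists (Rmin d1 d2). split; [now apply Rmin_pos|]. intros s Hs.
    assert (M1 := Rmin_l d1 d2). assert (M2 := Rmin_r d1 d2).
    specialize (H1' s ltac:(lra)). specialize (H2' s ltac:(lra)).
    eapply Rle_trans; [apply Cmod_le_sum|]. rewrite E1, E2. lra.
  - intros H. split; intros eps Heps; destruct (H eps Heps) as [d [Hd H']];
      exists d; (split; [exact Hd|]); intros s Hs;
      (eapply Rle_trans; [|apply H', Hs]).
    + rewrite <- E1. apply re_le_Cmod.
    + rewrite <- E2. apply im_le_Cmod.
Qed.

Lemma is_curve_derive_comp (F : C -> C) (g : R -> C) (t : R) (l l' : C) :
  @is_derive C_AbsRing C_NormedModule F (g t) l' -> is_curve_derive g t l ->
  is_curve_derive (fun s => F (g s)) t (l' * l)%C.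
Proof.
  intros HF Hg. rewrite is_curve_derive_spec in Hg |- *.
  rewrite is_C_derive_spec in HF. intros eps Heps.
  assert (Hl := Cmod_ge_0 l). assert (Hl' := Cmod_ge_0 l').
  (* The error of the composite is at most e1 |g s - g t| + |l'| e2 |s - t|, where |g s - g t| <=
     (|l| + 1) |s - t|; each summand gets half of [eps]. *)
  set (e1 := eps / (2 * (Cmod l + 1))). set (e2 := eps / (2 * (Cmod l' + 1))).
  assert (He1 : 0 < e1) by (apply Rdiv_lt_0_compat; lra).
  assert (He2 : 0 < e2) by (apply Rdiv_lt_0_compat; lra).
  assert (E1 : e1 * (Cmod l + 1) = eps / 2) by (unfold e1; field; lra).
  assert (E2 : e2 * (Cmod l' + 1) = eps / 2) by (unfold e2; field; lra).
  destruct (HF e1 He1) as [d [Hd H1]].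
  destruct (Hg 1 Rlt_0_1) as [d2 [Hd2 H2]].
  destruct (Hg e2 He2) as [d3 [Hd3 H3]].
  exists (Rmin (d / (Cmod l + 1)) (Rmin d2 d3)). split.
  { repeat apply Rmin_pos; try assumption. apply Rdiv_lt_0_compat; lra. }
  intros s Hs.
  assert (M1 := Rmin_l (d / (Cmod l + 1)) (Rmin d2 d3)).
  assert (M2 := Rmin_r (d / (Cmod l + 1)) (Rmin d2 d3)).
  assert (M3 := Rmin_l d2 d3). assert (M4 := Rmin_r d2 d3).
  specialize (H2 s ltac:(lra)). specialize (H3 s ltac:(lra)).
  assert (Hst := Rabs_pos (s - t)).
  assert (Hlip : Cmod (g s - g t) <= (Cmod l + 1) * Rabs (s - t)).
  { replace (g s - g t)%C
      with ((g s - g t - RtoC (s - t) * l) + RtoC (s - t) * l)%C by ring.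
    eapply Rle_trans; [apply Cmod_triangle|]. rewrite Cmod_mult, Cmod_R. lra. }
  assert (Hs1 : Rabs (s - t) < d / (Cmod l + 1)) by lra.
  apply Rmult_lt_compat_r with (r := Cmod l + 1) in Hs1; [|lra].
  unfold Rdiv in Hs1. rewrite Rmult_assoc, Rinv_l in Hs1 by lra.
  specialize (H1 (g s) ltac:(lra)).
  replace (F (g s) - F (g t) - RtoC (s - t) * (l' * l))%C
    with ((F (g s) - F (g t) - (g s - g t) * l')
          + l' * (g s - g t - RtoC (s - t) * l))%C by ring.
  eapply Rle_trans; [apply Cmod_triangle|]. rewrite Cmod_mult. nra.
Qed.

Lemma is_curve_derive_mult (g h : R -> C) (t : R) (l m : C) :
  is_curve_derive g t l -> is_curve_derive h t m ->
  is_curve_derive (fun s => g s * h s)%C t (l * h t + g t * m)%C.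
Proof.
  intros [g1 g2] [h1 h2]. split.
  - evar_last.
    { apply (is_derive_minus (fun s => fst (g s) * fst (h s))
                             (fun s => snd (g s) * snd (h s)));
        (apply (is_derive_mult (K := R_AbsRing)); [eassumption|eassumption|];
         intros; apply Rmult_comm). }
    simpl. unfold minus, plus, opp, mult; simpl. ring.
  - evar_last.
    { apply (is_derive_plus (fun s => fst (g s) * snd (h s))
                            (fun s => snd (g s) * fst (h s)));
        (apply (is_derive_mult (K := R_AbsRing)); [eassumption|eassumption|];
         intros; apply Rmult_comm). }
    simpl. unfold minus, plus, opp, mult; simpl. ring.
Qed.

Lemma is_curve_derive_const (w : C) (t : R) : is_curve_derive (fun _ => w) t (RtoC 0).
Proof. split; apply (@is_derive_const R_AbsRing R_NormedModule). Qed.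

Lemma is_curve_derive_cis (a t : R) :
  is_curve_derive (fun s => cis (a * s)) t (Ci * (RtoC a * cis (a * t)))%C.
Proof. split; simpl; auto_derive; try exact I; ring. Qed.

(** Stated for a general [F] and exponent [a] because it serves twice: for f with a = c, and for f'
    with a = c + k. *)
Lemma is_curve_derive_rotation (a k : R) (F : C -> C) (l z : C) (t : R) :
  @is_derive C_AbsRing C_NormedModule F (cis (k * t) * z)%C l ->
  is_curve_derive (fun s => cis (a * s) * F (cis (k * s) * z))%C t
    (cis (a * t) * (Ci * (RtoC a * F (cis (k * t) * z)
                          + RtoC k * (cis (k * t) * z * l))))%C.
Proof.
  intros HF.
  assert (Hw : is_curve_derive (fun s => cis (k * s) * z)%C t
                 (Ci * (RtoC k * cis (k * t)) * z)%C).
  { replace (Ci * (RtoC k * cis (k * t)) * z)%C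
      with (Ci * (RtoC k * cis (k * t)) * z + cis (k * t) * RtoC 0)%C by ring.
    apply (is_curve_derive_mult (fun s => cis (k * s)) (fun _ => z)).
    - apply is_curve_derive_cis.
    - apply is_curve_derive_const. }
  match goal with |- is_curve_derive _ _ ?u => replace u with
    (Ci * (RtoC a * cis (a * t)) * F (cis (k * t) * z)
     + cis (a * t) * (l * (Ci * (RtoC k * cis (k * t)) * z)))%C by ring end.
  apply (is_curve_derive_mult (fun s => cis (a * s))
           (fun s => F (cis (k * s) * z)%C)).
  - apply is_curve_derive_cis.
  - now apply (is_curve_derive_comp F (fun s => cis (k * s) * z)%C).
Qed.

(** The real mean value inequality is applied to each component, whence the factor 2. *)
Lemma curve_mean_value (g g' : R -> C) (D x y : R) :
  (forall t, Rabs (t - x) <= Rabs (y - x) ->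
     is_curve_derive g t (g' t) /\ Cmod (g' t) <= D) ->
  Cmod (g y - g x) <= 2 * D * Rabs (y - x).
Proof.
  intros H.
  assert (H1 : Rabs (fst (g y) - fst (g x)) <= D * Rabs (y - x)).
  { apply (bounded_variation (fun t => fst (g t)) (fun t => fst (g' t))).
    intros t Ht. destruct (H t Ht) as [[Hg _] HD]. split; [exact Hg|].
    eapply Rle_trans; [apply re_le_Cmod|exact HD]. }
  assert (H2 : Rabs (snd (g y) - snd (g x)) <= D * Rabs (y - x)).
  { apply (bounded_variation (fun t => snd (g t)) (fun t => snd (g' t))).
    intros t Ht. destruct (H t Ht) as [[_ Hg] HD]. split; [exact Hg|].
    eapply Rle_trans; [apply im_le_Cmod|exact HD]. }
  eapply Rle_trans; [apply Cmod_le_sum|].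
  change (Rabs (fst (g y) - fst (g x)) + Rabs (snd (g y) - snd (g x))
          <= 2 * D * Rabs (y - x)). lra.
Qed.

(** * The infinitesimal generator *)

Lemma lb_scalE (l : C) (f : little_bloch) (z : C) : lb_scal l f z = (l * f z)%C.
Proof. reflexivity. Qed.

Lemma is_C_derive_id_mult (F : C -> C) (z l : C) :
  @is_derive C_AbsRing C_NormedModule F z l ->
  @is_derive C_AbsRing C_NormedModule (fun y => y * F y)%C z (F z + z * l)%C.
Proof.
  intros HF. destruct (is_C_derive_lipschitz F z l HF) as [L [d1 [HL [Hd1 H1]]]].
  rewrite is_C_derive_spec in HF |- *. intros eps Heps.
  assert (Hz := Cmod_ge_0 z).
  set (e := eps / (2 * (Cmod z + 1))).
  assert (He : 0 < e) by (apply Rdiv_lt_0_compat; lra).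
  assert (Ee : e * (Cmod z + 1) = eps / 2) by (unfold e; field; lra).
  destruct (HF e He) as [d2 [Hd2 H2]].
  exists (Rmin (Rmin d1 d2) (eps / (2 * L))). split.
  { repeat apply Rmin_pos; try assumption. apply Rdiv_lt_0_compat; lra. }
  intros y Hy.
  assert (M1 := Rmin_l (Rmin d1 d2) (eps / (2 * L))).
  assert (M2 := Rmin_r (Rmin d1 d2) (eps / (2 * L))).
  assert (M3 := Rmin_l d1 d2). assert (M4 := Rmin_r d1 d2).
  specialize (H1 y ltac:(lra)). specialize (H2 y ltac:(lra)).
  assert (Hyz : Cmod (y - z) < eps / (2 * L)) by lra.
  replace (y * F y - z * F z - (y - z) * (F z + z * l))%C
    with (z * (F y - F z - (y - z) * l) + (y - z) * (F y - F z))%C by ring.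
  eapply Rle_trans; [apply Cmod_triangle|]. rewrite !Cmod_mult.
  set (d := Cmod (y - z)) in *. assert (Hd : 0 <= d) by apply Cmod_ge_0.
  assert (HLd : L * d <= eps / 2).
  { replace (eps / 2) with (L * (eps / (2 * L))) by (field; lra).
    apply Rmult_le_compat_l; lra. }
  assert (P1 : Cmod z * Cmod (F y - F z - (y - z) * l) <= Cmod z * (e * d))
    by (apply Rmult_le_compat_l; lra).
  assert (P2 : d * Cmod (F y - F z) <= d * (L * d))
    by (apply Rmult_le_compat_l; lra).
  nra.
Qed.

Definition generator_value (c k : R) (f : C -> C) (z : C) : C :=
  (Ci * (RtoC c * f z + RtoC k * (z * C_derive f z)))%C.

Lemma generator_value_in_little_bloch (c k : R) (f : C -> C) :
  in_little_bloch f -> in_little_bloch (fun z => z * C_derive f z)%C ->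
  in_little_bloch (generator_value c k f).
Proof.
  intros Hf Hzf. apply in_little_bloch_scal, in_little_bloch_plus;
    now apply in_little_bloch_scal.
Qed.

Lemma C_derive_id_mult_derive (f : C -> C) (z : C) :
  analytic_at f z ->
  C_derive (fun y => y * C_derive f y)%C z
  = (C_derive f z + z * C_derive (C_derive f) z)%C.
Proof.
  intros Hf. apply is_C_derive_unique, is_C_derive_id_mult.
  now apply analytic_is_derive, analytic_C_derive.
Qed.

(** Since (z f')' = f' + z f'', differentiation intertwines the operators i (c + k z d/dz) with
    parameters c and c + k, in parallel with [C_derive_rotation_group]. *)
Lemma C_derive_generator_value (c k : R) (f : C -> C) (z : C) :
  analytic_at f z -> analytic_at (fun z => z * C_derive f z)%C z ->
  C_derive (generator_value c k f) z = generator_value (c + k) k (C_derive f) z.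
Proof.
  intros Hf Hzf. unfold generator_value.
  rewrite C_derive_scal by (apply analytic_plus; now apply analytic_scal).
  rewrite C_derive_plus by now apply analytic_scal.
  rewrite !C_derive_scal, C_derive_id_mult_derive by assumption.
  rewrite RtoC_plus. ring.
Qed.

(** At a fixed z the orbit is differentiable for every f of the space, even if the candidate value
    of the generator lies outside it. At t = 0 this is the pointwise form of the generator. *)
Lemma is_curve_derive_rotation_group (c k t : R) (f : little_bloch) (z : C) :
  in_disc z ->
  is_curve_derive (fun s => rotation_group c k s f z) t
    (cis (c * t) * generator_value c k f (cis (k * t) * z))%C.
Proof.
  intros Hz.
  assert (H := is_curve_derive_rotation c k f _ z t
    (analytic_is_derive f _ (lb_analytic f _ (in_disc_rotate _ z (Cmod_cis (k * t)) Hz)))).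
  destruct H as [H1 H2].
  split; (eapply is_derive_ext; [|eassumption]);
    intros s; simpl; destruct (Rlt_dec (Cmod z) 1); try contradiction; reflexivity.
Qed.

Lemma is_curve_derive_minus_linear (g : R -> C) (t : R) (l w : C) :
  is_curve_derive g t l -> is_curve_derive (fun s => g s - RtoC s * w)%C t (l - w)%C.
Proof.
  rewrite !is_curve_derive_spec. intros H eps Heps.
  destruct (H eps Heps) as [d [Hd H']]. exists d. split; [exact Hd|].
  intros s Hs. specialize (H' s Hs).
  replace (g s - RtoC s * w - (g t - RtoC t * w) - RtoC (s - t) * (l - w))%C
    with (g s - g t - RtoC (s - t) * l)%C by (rewrite RtoC_minus; ring).
  exact H'.
Qed.

(** Mean value inequality for s -> g s - s w, whose derivative g' - w is small. *)
Lemma curve_linear_approx (g g' : R -> C) (w : C) (D t : R) :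
  (forall s, Rabs s <= Rabs t -> is_curve_derive g s (g' s) /\ Cmod (g' s - w) <= D) ->
  Cmod (g t - g 0 - RtoC t * w) <= 2 * D * Rabs t.
Proof.
  intros H.
  assert (M := curve_mean_value (fun s => g s - RtoC s * w)%C (fun s => g' s - w)%C D 0 t).
  rewrite Rminus_0_r in M.
  replace (g t - g 0 - RtoC t * w)%C
    with (g t - RtoC t * w - (g 0 - RtoC 0 * w))%C by ring.
  apply M. intros s Hs. rewrite Rminus_0_r in Hs. destruct (H s Hs) as [H1 H2].
  split; [now apply is_curve_derive_minus_linear|exact H2].
Qed.

Lemma rotation_group_linear_approx (c k : R) (f g : little_bloch) (D t : R) :
  in_little_bloch (fun z => z * C_derive f z)%C ->
  (forall z, in_disc z -> g z = generator_value c k f z) ->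
  (forall s, Rabs s <= Rabs t -> bloch_norm (minus (rotation_group c k s g) g) <= D) ->
  bloch_norm (minus (minus (rotation_group c k t f) f) (lb_scal (RtoC t) g))
  <= 4 * D * Rabs t.
Proof.
  intros Hzf Hg HD.
  replace (4 * D * Rabs t) with (2 * D * Rabs t + 2 * D * Rabs t) by ring.
  apply bloch_norm_le.
  - rewrite !lb_minusE, lb_scalE.
    rewrite <- (rotation_group_0 c k f) at 2.
    apply (curve_linear_approx (fun s => rotation_group c k s f (RtoC 0))
             (fun s => rotation_group c k s g (RtoC 0))).
    intros s Hs. split.
    + rewrite rotation_groupE by apply in_disc_0.
      rewrite Hg by (apply in_disc_rotate; [apply Cmod_cis|apply in_disc_0]).
      apply is_curve_derive_rotation_group, in_disc_0.
    + rewrite <- lb_minusE. eapply Rle_trans; [apply Cmod_0_le_norm|now apply HD].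
  - intros z Hz. assert (Hp := disc_weight_pos z Hz).
    unfold bloch_weight. rewrite !C_derive_lb_minus by exact Hz.
    simpl lb_fun at 3.
    rewrite C_derive_scal by now apply lb_analytic.
    rewrite C_derive_rotation_group by exact Hz.
    set (W := 1 - Cmod z ^ 2) in *.
    (* The norm controls the derivative of T_s g - g at z only through the weight, hence [D / W];
       multiplying back by [W], which does not depend on s, makes the bound uniform in z. *)
    assert (H : Cmod (cis ((c + k) * t) * C_derive f (cis (k * t) * z)
                      - C_derive f z - RtoC t * C_derive g z)
                <= 2 * (D / W) * Rabs t).
    (* f'(z) is the value at s = 0 of the curve to be linearised. *)
    { replace (C_derive f z) with (cis ((c + k) * 0) * C_derive f (cis (k * 0) * z))%C
        by (rewrite !Rmult_0_r, cis_0, !Cmult_1_l; reflexivity).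
      apply (curve_linear_approx
        (fun s => cis ((c + k) * s) * C_derive f (cis (k * s) * z))%C
        (fun s => C_derive (rotation_group c k s g) z)).
      intros s Hs. split.
      - rewrite C_derive_rotation_group by exact Hz.
        assert (Hr := in_disc_rotate _ z (Cmod_cis (k * s)) Hz).
        rewrite (C_derive_ext_disc (generator_value c k f) g).
        + rewrite C_derive_generator_value;
            [|now apply lb_analytic|now apply (proj1 (proj1 Hzf))].
          apply is_curve_derive_rotation.
          now apply analytic_is_derive, analytic_C_derive, lb_analytic.
        + intros y Hy. symmetry. now apply Hg.
        + apply generator_value_in_little_bloch; [apply lb_in|exact Hzf].
        + exact Hr.
      - rewrite <- C_derive_lb_minus by exact Hz.
        assert (H1 := bloch_weight_le_norm (minus (rotation_group c k s g) g) z Hz).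
        unfold bloch_weight in H1. fold W in H1. specialize (HD s Hs).
        apply Rmult_le_reg_l with W; [exact Hp|].
        replace (W * (D / W)) with D by (field; lra). lra. }
    apply (Rmult_le_compat_l W) in H; [|lra].
    replace (W * (2 * (D / W) * Rabs t)) with (2 * D * Rabs t) in H by (field; lra).
    exact H.
Qed.

Lemma generator_graph_spec (T : R -> little_bloch -> little_bloch) (f g : little_bloch) :
  generator_graph T f g <->
  forall eps : R, 0 < eps -> exists d : R, 0 < d /\ forall t, Rabs t < d -> t <> 0 ->
    bloch_norm (minus (lb_scal (RtoC (/ t)) (minus (T t f) f)) g) < eps.
Proof.
  split.
  - intros H eps Heps.
    destruct (proj1 (filterlim_locally _ _) H (mkposreal eps Heps)) as [d Hd].
    exists d. split; [apply cond_pos|]. intros t Ht Ht0. apply Hd; [|exact Ht0].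
    change (Rabs (t - 0) < d). now rewrite Rminus_0_r.
  - intros H. apply filterlim_locally. intros eps.
    destruct (H eps (cond_pos eps)) as [d [Hd H']].
    exists (mkposreal d Hd). intros t Ht Ht0. apply H'; [|exact Ht0].
    change (Rabs (t - 0) < d) in Ht. now rewrite Rminus_0_r in Ht.
Qed.

Lemma generator_graph_sufficient (c k : R) (f g : little_bloch) :
  in_little_bloch (fun z => z * C_derive f z)%C ->
  (forall z, in_disc z -> g z = generator_value c k f z) ->
  generator_graph (rotation_group c k) f g.
Proof.
  intros Hzf Hg. apply generator_graph_spec. intros eps Heps.
  (* Smallness comes from strong continuity at [g], not at [f]. After division by |t| the linear
     approximation leaves 4 eps / 5 < eps. *)
  destruct (rotation_group_near_0 c k g (eps / 5)) as [d [Hd H]]; [lra|].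
  exists d. split; [exact Hd|]. intros t Ht Ht0.
  assert (Hpos : 0 < Rabs t) by now apply Rabs_pos_lt.
  assert (H1 := rotation_group_linear_approx c k f g (eps / 5) t Hzf Hg).
  specialize (H1 ltac:(intros s Hs; apply Rlt_le, H; lra)).
  replace (minus (lb_scal (RtoC (/ t)) (minus (rotation_group c k t f) f)) g)
    with (lb_scal (RtoC (/ t))
            (minus (minus (rotation_group c k t f) f) (lb_scal (RtoC t) g))).
  - eapply Rle_lt_trans; [apply bloch_norm_scal|].
    rewrite Cmod_R, Rabs_inv.
    apply Rmult_lt_reg_l with (Rabs t); [exact Hpos|].
    rewrite <- Rmult_assoc, Rinv_r by lra. nra.
  - apply little_bloch_ext. intros z Hz.
    rewrite !lb_minusE, !lb_scalE, !lb_minusE, !lb_scalE.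
    rewrite RtoC_inv by exact Ht0. field. intros E. now apply Ht0, RtoC_inj.
Qed.

(** Point evaluations are bounded, so norm convergence implies pointwise convergence. On the segment
    from 0 to z the weight is at least W = 1 - |z|^2, hence |h'| is at most the norm over W there;
    in the constant, 1 accounts for h(0) and 2/W for the mean value inequality. *)
Lemma lb_eval_bound (z : C) : in_disc z ->
  exists K : R, 0 < K /\ forall h : little_bloch, Cmod (h z) <= K * bloch_norm h.
Proof.
  intros Hz. assert (Hp := disc_weight_pos z Hz).
  set (W := 1 - Cmod z ^ 2) in *.
  assert (HW : 0 < / W) by now apply Rinv_0_lt_compat.
  exists (1 + 2 * / W). split; [lra|]. intros h.
  (* The range is symmetric because [curve_mean_value] works on a ball around its base point, here
     0. *)
  assert (Hseg : forall s, Rabs s <= 1 -> in_disc (RtoC s * z)%C).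
  { intros s Hs. unfold in_disc in *. rewrite Cmod_mult, Cmod_R.
    assert (H0 := Cmod_ge_0 z). nra. }
  assert (H : Cmod (h (RtoC 1 * z)%C - h (RtoC 0 * z)%C)
              <= 2 * (/ W * bloch_norm h) * Rabs (1 - 0)).
  { apply (curve_mean_value (fun s => h (RtoC s * z)%C)
             (fun s => C_derive h (RtoC s * z) * z)%C).
    intros s Hs. rewrite !Rminus_0_r, Rabs_R1 in Hs. specialize (Hseg s Hs). split.
    - apply (is_curve_derive_comp h (fun s => RtoC s * z)%C).
      + apply analytic_is_derive, lb_analytic, Hseg.
      + rewrite is_curve_derive_spec. intros eps Heps. exists 1. split; [lra|].
        intros r _. replace (RtoC r * z - RtoC s * z - RtoC (r - s) * z)%C
          with (RtoC 0) by (rewrite RtoC_minus; ring).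
        rewrite Cmod_0. apply Rmult_le_pos; [lra|apply Rabs_pos].
    - assert (H1 := bloch_weight_le_norm h _ Hseg). unfold bloch_weight in H1.
      rewrite Cmod_mult. unfold in_disc in Hz.
      assert (P1 := Cmod_ge_0 z).
      assert (P2 := Cmod_ge_0 (C_derive h (RtoC s * z))).
      apply Rmult_le_reg_l with W; [exact Hp|].
      replace (W * (/ W * bloch_norm h)) with (bloch_norm h) by (field; lra).
      assert (Hle : W <= 1 - Cmod (RtoC s * z) ^ 2).
      { unfold W. rewrite Cmod_mult, Cmod_R, Rpow_mult_distr.
        assert (Rabs s ^ 2 <= 1) by (assert (Q := Rabs_pos s); nra).
        assert (0 <= Cmod z ^ 2) by apply pow2_ge_0. nra. }
      apply (Rmult_le_compat_r _ _ _ P2) in Hle.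
      assert (Hz1 : Cmod (C_derive h (RtoC s * z)) * Cmod z
                    <= Cmod (C_derive h (RtoC s * z))) by nra.
      apply (Rmult_le_compat_l W) in Hz1; lra. }
  replace (RtoC 1 * z)%C with z in H by ring.
  replace (RtoC 0 * z)%C with (RtoC 0) in H by ring.
  rewrite Rminus_0_r, Rabs_R1 in H.
  assert (H0 := Cmod_0_le_norm h).
  replace (h z) with ((h z - h (RtoC 0)) + h (RtoC 0))%C by ring.
  eapply Rle_trans; [apply Cmod_triangle|]. lra.
Qed.

(** At a fixed z the difference quotients tend to g(z), evaluation being bounded, and also to the
    derivative of the orbit at 0; the two limits agree. *)
Lemma generator_graph_value (c k : R) (f g : little_bloch) (z : C) :
  generator_graph (rotation_group c k) f g -> in_disc z ->
  g z = generator_value c k f z.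
Proof.
  intros H Hz. rewrite generator_graph_spec in H.
  destruct (lb_eval_bound z Hz) as [K [HK HKe]].
  set (l := generator_value c k f z).
  assert (Hl : is_curve_derive (fun s => rotation_group c k s f z) 0 l).
  { assert (H0 := is_curve_derive_rotation_group c k 0 f z Hz).
    rewrite !Rmult_0_r, cis_0, !Cmult_1_l in H0. exact H0. }
  rewrite is_curve_derive_spec in Hl.
  assert (E : Cmod (g z - l) <= 0).
  { apply le_epsilon. intros eps Heps.
    set (e := eps / (K + 1)).
    assert (He : 0 < e) by (apply Rdiv_lt_0_compat; lra).
    assert (Ee : e * (K + 1) = eps) by (unfold e; field; lra).
    destruct (H e He) as [d1 [Hd1 H1]]. destruct (Hl e He) as [d2 [Hd2 H2]].
    (* One nonzero time below both thresholds suffices: its quotient is within K e of g(z) and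
       within e of [l], and e (K + 1) = eps. *)
    set (t := Rmin d1 d2 / 2).
    assert (Hm : 0 < Rmin d1 d2) by now apply Rmin_pos.
    assert (M1 := Rmin_l d1 d2). assert (M2 := Rmin_r d1 d2).
    assert (Ht : 0 < t) by (unfold t; lra).
    assert (Hta : Rabs t = t) by (apply Rabs_pos_eq; lra).
    specialize (H1 t ltac:(rewrite Hta; unfold t; lra) ltac:(lra)).
    specialize (H2 t). rewrite Rminus_0_r, Hta in H2.
    specialize (H2 ltac:(unfold t; lra)).
    rewrite rotation_group_0 in H2.
    assert (H3 := HKe (minus (lb_scal (RtoC (/ t))
                         (minus (rotation_group c k t f) f)) g)).
    rewrite lb_minusE, lb_scalE, lb_minusE in H3.
    set (q := (rotation_group c k t f z - f z)%C) in *.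
    assert (H4 : Cmod (RtoC (/ t) * q - l) <= e).
    { replace (RtoC (/ t) * q - l)%C with (RtoC (/ t) * (q - RtoC t * l))%C.
      - rewrite Cmod_mult, Cmod_R, Rabs_inv, Hta.
        apply Rmult_le_reg_l with t; [exact Ht|].
        rewrite <- Rmult_assoc, Rinv_r by lra. lra.
      - rewrite RtoC_inv by lra. field. intros E. apply RtoC_inj in E. lra. }
    replace (g z - l)%C
      with (- (RtoC (/ t) * q - g z) + (RtoC (/ t) * q - l))%C by ring.
    eapply Rle_trans; [apply Cmod_triangle|]. rewrite Cmod_opp.
    apply Rlt_le, (Rmult_le_compat_l K) in H1; [|lra]. lra. }
  assert (E0 : (g z - l)%C = RtoC 0).
  { apply Cmod_eq_0. assert (P := Cmod_ge_0 (g z - l)). lra. }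
  replace (g z) with ((g z - l) + l)%C by ring. rewrite E0. ring.
Qed.

Theorem proposition2p1 (c k : R) (hk : k <> 0) :
  exists T : R -> little_bloch -> little_bloch,
    (forall (t : R) (f : little_bloch) (z : C), in_disc z ->
       T t f z = (cis (c * t) * f (cis (k * t) * z))%C) /\
    (strongly_continuous_group T /\ group_of_isometries T) /\
    (forall f : little_bloch,
       generator_domain T f <->
       in_little_bloch (fun z : C => (z * C_derive f z)%C)) /\
    (forall f g : little_bloch, generator_graph T f g ->
       forall z : C, in_disc z ->
         g z = (Ci * (RtoC c * f z + RtoC k * (z * C_derive f z)))%C).
Proof.
  exists (rotation_group c k). split; [|split; [split|split]].
  - apply rotation_groupE.
  - apply rotation_group_strongly_continuous.
  - intros t f. apply bloch_norm_rotation_group.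
  - intros f. split.
    + intros [g Hg].
      (* Solving g = i (c f + k z f') for z f', which is where k is inverted, writes it as a linear
         combination of [f] and [g]; analyticity and decay are inherited from the space. *)
      apply in_little_bloch_ext
        with (fun z => RtoC (/ k) * (- Ci * g z + - RtoC c * f z))%C.
      * intros z Hz. rewrite (generator_graph_value c k f g z Hg Hz).
        unfold generator_value.
        replace (- Ci * (Ci * (RtoC c * f z + RtoC k * (z * C_derive f z))))%C
          with (- (Ci * Ci) * (RtoC c * f z + RtoC k * (z * C_derive f z)))%C by ring.
        replace (Ci * Ci)%C with (- RtoC 1)%C
          by (apply injective_projections; simpl; ring).
        rewrite RtoC_inv by exact hk. field. intros E. now apply hk, RtoC_inj.
      * apply in_little_bloch_scal, in_little_bloch_plus;
          apply in_little_bloch_scal, lb_in.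
    + intros Hzf.
      exists (lb_of _ (generator_value_in_little_bloch c k f (lb_in f) Hzf)).
      apply generator_graph_sufficient; [exact Hzf|]. apply lb_ofE.
  - intros f g Hg z Hz. exact (generator_graph_value c k f g z Hg Hz).
Qed.
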